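(* Let $F$ denote the solution on $[0,\infty)$ of the initial value problem $F'''(x)+F(x)F''(x)=0$ for $x\in(0,\infty)$, $F(0)=0$, $F'(0)=0$, $F''(0)=1$. For $(a,b,c)\in\mathbb{R}^3$ define $$F_0(x)=\begin{cases}\dfrac{x^2}{2}+x^4P\left(\tfrac25 x\right), & x\in[0,\tfrac52],\\[2mm] ax+b+\sqrt{\dfrac{a}{2t(x)}}\;q_0(t(x)), & x>\tfrac52,\end{cases}$$ with $P$, $t(x)$, $q_0$ as given in the context. Then there is a unique triple $(a,b,c)\in\mathcal{S}$, where $$\mathcal{S}=\left\{(a,b,c)\in\mathbb{R}^3:\sqrt{(a-a_0)^2+\tfrac14(b-b_0)^2+\tfrac14(c-c_0)^2}\le\rho_0:=5\times10^{-5}\right\},\qquad (a_0,b_0,c_0)=\left(\tfrac{3221}{1946},-\tfrac{2763}{1765},\tfrac{377}{1613}\right),$$ with the property that $F(x)=F_0(x)+E(x)$, where the error term $E$ satisfies $$\|E''\|_\infty\le 3.5\times10^{-6},\quad \|E'\|_\infty\le4.5\times10^{-6},\quad \|E\|_\infty\le4\times10^{-6}\quad\text{on }[0,\tfrac52],$$ and, for $x\ge\frac52$, with $t=t(x)$, $$|E(x)|\le1.69\times10^{-5}\,t^{-2}e^{-3t},\quad \left|\frac{d}{dx}E(x)\right|\le9.20\times10^{-5}\,t^{-3/2}e^{-3t},\quad \left|\frac{d^2}{dx^2}E(x)\right|\le5.02\times10^{-4}\,t^{-1}e^{-3t}.$$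
   Context: The polynomial $P$ is $$P(y)=\sum_{j=0}^{12}\frac{2}{5(j+2)(j+3)(j+4)}\,p_j\,y^j,$$ with $[p_0,\dots,p_{12}]$ equal to $$\Big[-\tfrac{510}{10445149},\,-\tfrac{18523}{5934},\,-\tfrac{42998}{441819},\,\tfrac{113448}{81151},\,-\tfrac{65173}{22093},\,\tfrac{390101}{6016},\,-\tfrac{2326169}{9858},\,\tfrac{4134879}{7249},\,-\tfrac{1928001}{1960},\,\tfrac{20880183}{19117},\,-\tfrac{1572554}{2161},\,\tfrac{1546782}{5833},\,-\tfrac{1315241}{32239}\Big].$$ Given $(a,b,c)$, set $t(x)=\frac a2\left(x+\frac ba\right)^2$, $$I_0(t)=1-\sqrt{\pi t}\,e^{t}\,\mathrm{erfc}(\sqrt t),\qquad J_0(t)=1-\sqrt{2\pi t}\,e^{2t}\,\mathrm{erfc}(\sqrt{2t}),$$ $$q_0(t)=2c\sqrt t\,e^{-t}I_0(t)+c^2e^{-2t}\left(2J_0(t)-I_0(t)-I_0(t)^2\right),$$ where $\mathrm{erfc}$ is the complementary error function. $\|\cdot\|_\infty$ is the sup norm. The function $F_0$ need not be continuous at $x=\frac52$: in the bounds on $[0,\frac52]$, $E$ and its derivatives are computed with the polynomial formula for $F_0$ (including at the endpoint $x=\frac52$), and in the bounds for $x\ge\frac52$ they are computed with the formula $F_0(x)=ax+b+\sqrt{a/(2t(x))}\,q_0(t(x))$ (including at $x=\frac52$). *)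

(* Defs.v *)
(* Stdlib reals with Coquelicot. *)
From Stdlib Require Import Reals List.
From Coquelicot Require Import Coquelicot.
Import ListNotations.
Open Scope R_scope.

(* Derivative of [f] relative to the set [D]: one-sided at the endpoints of an
   interval.  Only the values of [f] and [f'] on [D] matter. *)
Definition derivative_on (D : R -> Prop) (f f' : R -> R) : Prop :=
  forall x, D x ->
    filterlim (fun y => (f y - f x) / (y - x))
      (within D (locally' x)) (locally (f' x)).

Definition sup_norm_on (D : R -> Prop) (f : R -> R) : Rbar :=
  Lub_Rbar (fun r => exists x, D x /\ r = Rabs (f x)).

Definition blasius_solution (F : R -> R) : Prop :=
  exists F' F'' F''' : R -> R,
    derivative_on (fun x => 0 <= x) F F' /\
    derivative_on (fun x => 0 <= x) F' F'' /\
    derivative_on (fun x => 0 < x) F'' F''' /\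
    (forall x, 0 < x -> F''' x + F x * F'' x = 0) /\
    F 0 = 0 /\ F' 0 = 0 /\ F'' 0 = 1.

Definition p_coef : list R :=
  [ - (510 / 10445149); - (18523 / 5934); - (42998 / 441819);
    113448 / 81151; - (65173 / 22093); 390101 / 6016;
    - (2326169 / 9858); 4134879 / 7249; - (1928001 / 1960);
    20880183 / 19117; - (1572554 / 2161); 1546782 / 5833;
    - (1315241 / 32239) ].

Definition P (y : R) : R :=
  sum_f_R0 (fun j =>
    2 / (5 * (INR j + 2) * (INR j + 3) * (INR j + 4)) * nth j p_coef 0 * y ^ j)
    12.

Definition erfc (z : R) : R :=
  2 / sqrt PI *
  RInt_gen (fun s => exp (- s ^ 2)) (at_point z) (Rbar_locally p_infty).

Definition I0 (t : R) : R := 1 - sqrt (PI * t) * exp t * erfc (sqrt t).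

Definition J0 (t : R) : R :=
  1 - sqrt (2 * PI * t) * exp (2 * t) * erfc (sqrt (2 * t)).

Definition q0 (c t : R) : R :=
  2 * c * sqrt t * exp (- t) * I0 t +
  c ^ 2 * exp (- (2 * t)) * (2 * J0 t - I0 t - I0 t ^ 2).

Definition tvar (a b x : R) : R := a / 2 * (x + b / a) ^ 2.

Definition F0_near (x : R) : R := x ^ 2 / 2 + x ^ 4 * P (2 / 5 * x).

Definition F0_far (a b c x : R) : R :=
  a * x + b + sqrt (a / (2 * tvar a b x)) * q0 c (tvar a b x).

Definition a0 : R := 3221 / 1946.
Definition b0 : R := - (2763 / 1765).
Definition c0 : R := 377 / 1613.
Definition rho0 : R := 5 / 10 ^ 5.

Definition in_S (a b c : R) : Prop :=
  sqrt ((a - a0) ^ 2 + 1 / 4 * (b - b0) ^ 2 + 1 / 4 * (c - c0) ^ 2) <= rho0.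

(* The approximation [F0] is [F0_near] on [0, 5/2] and [F0_far a b c] beyond.
   It may jump at 5/2, so the error E = F - F0 is taken on each closed piece
   with the formula of that piece, the point 5/2 belonging to both. *)
Definition near_error_bounds (F : R -> R) : Prop :=
  let D := fun x => 0 <= x <= 5 / 2 in
  let E := fun x => F x - F0_near x in
  exists E' E'' : R -> R,
    derivative_on D E E' /\ derivative_on D E' E'' /\
    Rbar_le (sup_norm_on D E'') (35 / 10 ^ 7) /\
    Rbar_le (sup_norm_on D E') (45 / 10 ^ 7) /\
    Rbar_le (sup_norm_on D E) (4 / 10 ^ 6).

Definition far_error_bounds (F : R -> R) (a b c : R) : Prop :=
  let D := fun x => 5 / 2 <= x in
  let E := fun x => F x - F0_far a b c x in
  exists E' E'' : R -> R,
    derivative_on D E E' /\ derivative_on D E' E'' /\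
    forall x, D x ->
      let t := tvar a b x in
      Rabs (E x) <= 169 / 10 ^ 7 * Rpower t (- 2) * exp (- (3 * t)) /\
      Rabs (E' x) <= 920 / 10 ^ 7 * Rpower t (- (3 / 2)) * exp (- (3 * t)) /\
      Rabs (E'' x) <= 502 / 10 ^ 6 * Rpower t (- 1) * exp (- (3 * t)).

(* Main.v *)
(* Writing Phi for the integral of F, the equation reads F'' = exp (- Phi).

   Near field: an explicit polynomial approximation of Phi on [0, 9/2] satisfies
   the differential equation up to 10^-10, and an energy estimate turns this
   into bounds of order 10^-7 for F, F', F''; these are compared with [F0_near]
   by bounding polynomials with integer coefficients on small cells.

   Far field: F'' decays like a Gaussian, so F' -> a, F - a x -> b and
   (a x + b)^2 / (2 a) - Phi -> l, which defines c by e^l = sqrt 2 a^(3/2) c and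
   shows uniqueness; evaluating at x = 9/2 places (a, b, c) in the set S.  In the
   variable s = sqrt t, the function V = t - Phi - l solves
   V''' = - 4 c exp (V - s^2) with V, V', V'' -> 0.  Its first two iterates
   starting from V = 0 give exactly the terms of [F0_far] linear and quadratic in
   c, so the error solves e'' = 4 c exp (- s^2) (exp V - 1 - c H), where c H is the
   first iterate.  Signs and sizes follow from comparing derivatives of functions
   vanishing at infinity. *)
Require Import Defs.
From Stdlib Require Import Reals Lra Lia ZArith List.
From Coquelicot Require Import Coquelicot.
Import ListNotations.
Open Scope R_scope.

(** * Comparison of functions through their derivatives *)

(** The formulas meet at 5/2, but the asymptotic constants are read off at 9/2. At 5/2 the second
    derivative of F is still about 0.1, and integrating its tail would locate a only to within a few
    hundredths, whereas S has radius 5 10^-5; at 9/2 it has dropped to about 2 10^-5. The price is a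
    polynomial of degree 40 that is accurate on all of [0, 9/2]. The far bounds are claimed down to
    s = 1.414, where asymptotic expansions of erfc are too crude, and they leave only about ten
    percent of room. Hence the majorants of the Gaussian iterates are elementary functions tuned to
    s >= 1.413, and the nonlinearity is controlled by an a priori bound exp V <= 1.03, which itself
    comes from the numerical values at 5/2 and 9/2. *)

Lemma is_derive_continuity_pt (f : R -> R) (x l : R) :
  is_derive f x l -> continuity_pt f x.
Proof.
intros H; apply derivable_continuous_pt; exists l; now apply is_derive_Reals.
Qed.

Lemma derive_nonneg_le (f f' : R -> R) (a b : R) :
  a <= b -> (forall x, a <= x <= b -> is_derive f x (f' x)) ->
  (forall x, a <= x <= b -> 0 <= f' x) -> f a <= f b.
Proof.
intros ab D P.
destruct (MVT_gen f a b f') as [c [Hc E]].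
- intros x; rewrite Rmin_left, Rmax_right by lra; intros Hx; apply D; lra.
- intros x; rewrite Rmin_left, Rmax_right by lra; intros Hx.
  now apply (is_derive_continuity_pt f x (f' x)), D.
- rewrite Rmin_left, Rmax_right in Hc by lra.
  pose proof (P c Hc); nra.
Qed.

Lemma derive_le (f g f' g' : R -> R) (a b : R) :
  a <= b -> (forall x, a <= x <= b -> is_derive f x (f' x)) ->
  (forall x, a <= x <= b -> is_derive g x (g' x)) ->
  (forall x, a <= x <= b -> f' x <= g' x) -> f b - f a <= g b - g a.
Proof.
intros ab Df Dg P.
enough (g a - f a <= g b - f b) by lra.
apply (derive_nonneg_le (fun x => g x - f x) (fun x => g' x - f' x)); trivial.
- intros x Hx; apply @is_derive_minus; auto.
- intros x Hx; specialize (P x Hx); lra.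
Qed.

Lemma is_lim_p_infty_eps (f : R -> R) (l : R) :
  is_lim f p_infty l <->
  forall e, 0 < e -> exists A, forall x, A < x -> Rabs (f x - l) < e.
Proof.
split.
- intros H e He; apply is_lim_spec in H; exact (H (mkposreal e He)).
- intros H; apply is_lim_spec; intros [e He]; exact (H e He).
Qed.

Lemma is_lim_scal0 (f : R -> R) (k : R) :
  is_lim f p_infty 0 -> is_lim (fun x => k * f x) p_infty 0.
Proof.
intros H; replace (Finite 0) with (Rbar_mult k 0) by (simpl; f_equal; ring).
now apply is_lim_scal_l.
Qed.

Lemma is_lim_plus0 (f g : R -> R) :
  is_lim f p_infty 0 -> is_lim g p_infty 0 ->
  is_lim (fun x => f x + g x) p_infty 0.
Proof.
intros Hf Hg; replace (Finite 0) with (Finite (0 + 0)) by (f_equal; ring).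
now apply is_lim_plus'.
Qed.

Lemma is_lim_squeeze0 (f g : R -> R) (A : R) :
  (forall x, A < x -> Rabs (f x) <= g x) ->
  is_lim g p_infty 0 -> is_lim f p_infty 0.
Proof.
intros H; rewrite 2!is_lim_p_infty_eps; intros G e He.
destruct (G e He) as [B HB]; exists (Rmax A B); intros x Hx.
pose proof (Rmax_l A B); pose proof (Rmax_r A B).
specialize (H x ltac:(lra)); specialize (HB x ltac:(lra)).
rewrite Rminus_0_r in *.
pose proof (Rle_abs (g x)); lra.
Qed.

Lemma decay_nonneg (f f' : R -> R) (a : R) :
  (forall x, a <= x -> is_derive f x (f' x)) ->
  (forall x, a <= x -> f' x <= 0) -> is_lim f p_infty 0 ->
  forall x, a <= x -> 0 <= f x.
Proof.
intros D P L x Hx.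
destruct (Rle_lt_dec 0 (f x)) as [h|h]; trivial; exfalso.
destruct (proj1 (is_lim_p_infty_eps f 0) L (- f x) ltac:(lra)) as [A HA].
set (y := Rmax (A + 1) x).
assert (Hy : A < y /\ x <= y).
{ unfold y; pose proof (Rmax_l (A + 1) x); pose proof (Rmax_r (A + 1) x); lra. }
specialize (HA y (proj1 Hy)).
assert (- f x <= - f y).
{ apply (derive_nonneg_le (fun z => - f z) (fun z => - f' z)); [lra| |].
  - intros z Hz; apply @is_derive_opp; apply D; lra.
  - intros z Hz; specialize (P z ltac:(lra)); lra. }
apply Rabs_def2 in HA; lra.
Qed.

Lemma decay_le (f g f' g' : R -> R) (a : R) :
  (forall x, a <= x -> is_derive f x (f' x)) ->
  (forall x, a <= x -> is_derive g x (g' x)) ->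
  (forall x, a <= x -> g' x <= f' x) ->
  is_lim f p_infty 0 -> is_lim g p_infty 0 ->
  forall x, a <= x -> f x <= g x.
Proof.
intros Df Dg P Lf Lg x Hx.
enough (0 <= g x + -1 * f x) by lra.
apply (decay_nonneg (fun x => g x + -1 * f x) (fun x => g' x + -1 * f' x) a);
  trivial.
- intros z Hz; apply @is_derive_plus; [now apply Dg|].
  apply @is_derive_scal; now apply Df.
- intros z Hz; specialize (P z Hz); lra.
- now apply is_lim_plus0; [|apply is_lim_scal0].
Qed.

Lemma is_lim_nonincreasing (f : R -> R) (a B : R) :
  (forall x y, a <= x -> x <= y -> f y <= f x) ->
  (forall x, a <= x -> B <= f x) ->
  exists l : R, is_lim f p_infty l /\ forall x, a <= x -> l <= f x.
Proof.
intros M LB.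
destruct (completeness (fun r => exists x, a <= x /\ r = - f x)) as [s [Us Ls]].
- exists (- B); intros r [x [Hx ->]]; specialize (LB x Hx); lra.
- exists (- f a), a; split; [lra|trivial].
- exists (- s); split.
  + apply is_lim_p_infty_eps; intros e He.
    destruct (Classical_Prop.classic (exists x, a <= x /\ f x < - s + e))
      as [[x [Hx Fx]]|N].
    * exists x; intros y Hy.
      pose proof (M x y Hx ltac:(lra)).
      pose proof (Us (- f y) (ex_intro _ y (conj (Rle_trans _ _ _ Hx (Rlt_le _ _ Hy)) eq_refl))).
      apply Rabs_def1; lra.
    * exfalso; enough (s <= s - e) by lra.
      apply Ls; intros r [x [Hx ->]].
      apply Rnot_lt_le; intros h; apply N; exists x; split; trivial; lra.
  + intros x Hx; pose proof (Us (- f x) (ex_intro _ x (conj Hx eq_refl))); lra.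
Qed.

Lemma is_lim_exp_decay (k X : R) :
  0 < k -> is_lim (fun x => exp (- (k * (x - X)))) p_infty 0.
Proof.
intros Hk; apply is_lim_p_infty_eps; intros e He.
exists (X + (- ln e) / k); intros x Hx.
rewrite Rminus_0_r, Rabs_pos_eq by (left; apply exp_pos).
rewrite <- (exp_ln e He); apply exp_increasing.
assert (- ln e < k * (x - X)); [|lra].
replace (- ln e) with (k * (- ln e / k)) by (field; lra).
apply Rmult_lt_compat_l; lra.
Qed.

(** The bound on [r] is minus the derivative of K exp (- k (x - X)), so [f] loses at most K after X
    and converges by monotonicity. Integrating from infinity turns the rate bound K k into the bound
    K on the remainder, which lets the lemma be iterated. *)
Lemma lim_of_exp_decay (f r : R -> R) (X K k : R) :
  0 < k ->
  (forall x, X <= x -> is_derive f x (- r x)) ->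
  (forall x, X <= x -> 0 <= r x <= K * k * exp (- (k * (x - X)))) ->
  exists l : R, is_lim f p_infty l /\
    forall x, X <= x -> l <= f x <= l + K * exp (- (k * (x - X))).
Proof.
intros Hk D P.
assert (DK : forall x, is_derive (fun x => K * exp (- (k * (x - X)))) x
               (- (K * k * exp (- (k * (x - X)))))).
{ intros x; auto_derive; trivial; unfold Rminus; ring. }
destruct (is_lim_nonincreasing f X (f X - K)) as [l [Ll Hl]].
- intros x y Hx Hy.
  enough (- f x <= - f y) by lra.
  apply (derive_nonneg_le (fun z => - f z) (fun z => - - r z)); trivial.
  + intros z Hz; apply @is_derive_opp; apply D; lra.
  + intros z Hz; specialize (P z ltac:(lra)); lra.
- intros x Hx.
  pose proof (derive_le _ f _ (fun z => - r z) X x Hx (fun z _ => DK z)) as H.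
  specialize (H ltac:(intros z Hz; apply D; lra)).
  specialize (H ltac:(intros z Hz; specialize (P z ltac:(lra)); lra)).
  cbv beta in H; replace (- (k * (X - X))) with 0 in H by ring; rewrite exp_0 in H.
  assert (0 <= K * exp (- (k * (x - X)))).
  { pose proof (exp_pos (- (k * (x - X)))); specialize (P x Hx).
    assert (0 <= K * k * exp (- (k * (x - X)))) by lra.
    assert (0 <= K * exp (- (k * (x - X))) * k) by lra.
    apply Rmult_le_reg_r with k; lra. }
  lra.
- exists l; split; trivial; intros x Hx; split; [now apply Hl|].
  enough (f x - l <= K * exp (- (k * (x - X)))) by lra.
  apply (decay_le (fun x => f x - l) (fun x => K * exp (- (k * (x - X))))
    (fun x => - r x) (fun x => - (K * k * exp (- (k * (x - X))))) X); trivial.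
  + intros z Hz; replace (- r z) with (- r z - 0) by ring.
    apply @is_derive_minus; [now apply D|apply @is_derive_const].
  + intros z Hz; specialize (P z Hz); lra.
  + replace (Finite 0) with (Finite (l - l)) by (f_equal; ring).
    apply is_lim_minus'; [trivial|apply is_lim_const].
  + now apply is_lim_scal0, is_lim_exp_decay.
Qed.

(** * Derivatives relative to a set versus ordinary derivatives *)

Lemma derivative_on_is_derive (D : R -> Prop) (F g g' : R -> R) :
  (forall x, D x -> F x = g x) -> (forall x, D x -> is_derive g x (g' x)) ->
  derivative_on D F g'.
Proof.
intros E Dg x Hx.
specialize (Dg x Hx); apply is_derive_Reals in Dg.
intros P [e He]; destruct (Dg e (cond_pos e)) as [d Hd].
exists d; intros y Hy Ny Dy; apply He.
rewrite (E x Hx), (E y Dy).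
replace y with (x + (y - x)) at 1 by ring.
apply Hd; [lra|exact Hy].
Qed.

Lemma is_derive_derivative_on (D : R -> Prop) (F F' : R -> R) (x : R) :
  derivative_on D F F' -> D x -> locally x D -> is_derive F x (F' x).
Proof.
intros H Hx [d0 L]; apply is_derive_Reals; intros e He.
destruct (H x Hx (fun z => Rabs (z - F' x) < e)) as [d Hd].
{ exists (mkposreal e He); intros z Hz; exact Hz. }
exists (mkposreal _ (Rmin_stable_in_posreal d d0)); intros h Nh Hh; simpl in Hh.
pose proof (Rmin_l d d0); pose proof (Rmin_r d d0).
assert (B : forall r : posreal, Rabs h < r -> ball x r (x + h)).
{ intros r Hr; change (Rabs (x + h - x) < r).
  now replace (x + h - x) with h by ring. }
specialize (Hd (x + h) (B d ltac:(lra)) ltac:(lra) (L _ (B d0 ltac:(lra)))).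
now replace (x + h - x) with h in Hd by ring.
Qed.

(** * Bounding integer polynomials *)

Fixpoint peval (l : list Z) (x : R) : R :=
  match l with nil => 0 | a :: l => IZR a + x * peval l x end.

Fixpoint padd (p q : list Z) : list Z :=
  match p, q with
  | nil, _ => q
  | _, nil => p
  | a :: p, b :: q => (a + b)%Z :: padd p q
  end.

Definition pscal (k : Z) (p : list Z) : list Z := map (Z.mul k) p.

Fixpoint pmul (p q : list Z) : list Z :=
  match p with nil => nil | a :: p => padd (pscal a q) (0%Z :: pmul p q) end.

Fixpoint pderiv (p : list Z) : list Z :=
  match p with nil => nil | _ :: p => padd p (0%Z :: pderiv p) end.

Fixpoint pshift (m : Z) (p : list Z) : list Z :=
  match p with
  | nil => nil
  | a :: p => let s := pshift m p in padd (a :: s) (pscal m s)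
  end.

Fixpoint pabs (p : list Z) : Z :=
  match p with nil => 0%Z | a :: p => (Z.abs a + pabs p)%Z end.

Fixpoint pevalZ (l : list Z) (x : Z) : Z :=
  match l with nil => 0%Z | a :: l => (a + x * pevalZ l x)%Z end.

Lemma peval_add p q x : peval (padd p q) x = peval p x + peval q x.
Proof.
revert q; induction p as [|a p IH]; intros [|b q]; simpl; try ring.
rewrite plus_IZR, IH; ring.
Qed.

Lemma peval_scal k p x : peval (pscal k p) x = IZR k * peval p x.
Proof.
induction p as [|a p IH]; simpl; [ring|].
change (IZR (k * a) + x * peval (pscal k p) x = IZR k * (IZR a + x * peval p x)).
rewrite mult_IZR, IH; ring.
Qed.

Lemma peval_mul p q x : peval (pmul p q) x = peval p x * peval q x.
Proof.
induction p as [|a p IH]; simpl; [ring|].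
rewrite peval_add, peval_scal; simpl; rewrite IH; ring.
Qed.

Lemma peval_shift m p x : peval (pshift m p) x = peval p (x + IZR m).
Proof.
induction p as [|a p IH]; [reflexivity|].
change (pshift m (a :: p)) with (padd (a :: pshift m p) (pscal m (pshift m p))).
rewrite peval_add, peval_scal; simpl; rewrite IH; ring.
Qed.

Lemma peval_IZR p m : peval p (IZR m) = IZR (pevalZ p m).
Proof.
induction p as [|a p IH]; simpl; trivial.
now rewrite plus_IZR, mult_IZR, IH.
Qed.

Lemma is_derive_peval p x : is_derive (peval p) x (peval (pderiv p) x).
Proof.
induction p as [|a p IH]; simpl; [apply @is_derive_const|].
rewrite peval_add; simpl.
replace (peval p x + (0 + x * peval (pderiv p) x))
  with (0 + (1 * peval p x + x * peval (pderiv p) x)) by ring.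
apply @is_derive_plus; [apply @is_derive_const|].
apply (is_derive_mult (fun x : R => x)); [apply @is_derive_id|exact IH|].
intros; apply Rmult_comm.
Qed.

Lemma peval_abs p x : Rabs x <= 1 -> Rabs (peval p x) <= IZR (pabs p).
Proof.
intros Hx; induction p as [|a p IH]; simpl; [rewrite Rabs_R0; lra|].
rewrite plus_IZR, abs_IZR.
apply Rle_trans with (1 := Rabs_triang _ _).
rewrite Rabs_mult.
pose proof (Rabs_pos x); pose proof (Rabs_pos (peval p x)); nra.
Qed.

(* On each cell [2i, 2i+2], [i < n], recentred at [2i+1], the sum of the absolute
   values of the coefficients is a bound. *)
Fixpoint pbound_check (p : list Z) (B : Z) (n : nat) : bool :=
  match n with
  | O => true
  | S i => (pabs (pshift (2 * Z.of_nat i + 1) p) <=? B)%Z && pbound_check p B i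
  end.

Lemma pbound_check_correct p B n y :
  pbound_check p B n = true -> 0 <= y <= 2 * INR n ->
  (0 < n)%nat -> Rabs (peval p y) <= IZR B.
Proof.
induction n as [|n IH]; [lia|]; intros C Hy _; simpl pbound_check in C.
apply andb_prop in C as [C1 C2]; apply Z.leb_le, IZR_le in C1.
destruct (Rle_lt_dec y (2 * INR n)) as [h|h].
- destruct n as [|n].
  + simpl in h, C1; apply Rle_trans with (2 := C1).
    replace y with ((y - 1) + IZR 1) by ring; rewrite <- peval_shift.
    apply peval_abs, Rabs_le; lra.
  + apply IH; [trivial|lra|lia].
- apply Rle_trans with (2 := C1).
  replace y with ((y - IZR (2 * Z.of_nat n + 1)) + IZR (2 * Z.of_nat n + 1)) by ring.
  rewrite <- peval_shift.
  apply peval_abs, Rabs_le.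
  rewrite plus_IZR, mult_IZR, <- INR_IZR_INZ.
  rewrite S_INR in Hy; simpl; lra.
Qed.

(* The damping term [F e''] has the good sign and drops out of the energy
   inequality [N' <= 3 N + k^2]. *)
Lemma energy_bound (F q e e1 e2 r : R -> R) (X k : R) :
  0 <= X -> 0 < k ->
  (forall x, 0 <= x <= X -> is_derive e x (e1 x)) ->
  (forall x, 0 <= x <= X -> is_derive e1 x (e2 x)) ->
  (forall x, 0 <= x <= X ->
     is_derive e2 x (- (F x * e2 x) - q x * e x - r x)) ->
  (forall x, 0 <= x <= X -> 0 <= F x) ->
  (forall x, 0 <= x <= X -> Rabs (q x) <= 11 / 10) ->
  (forall x, 0 <= x <= X -> Rabs (r x) <= k) ->
  e 0 = 0 -> e1 0 = 0 -> e2 0 = 0 ->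
  forall x, 0 <= x <= X ->
    e x ^ 2 + e1 x ^ 2 + e2 x ^ 2 <= k ^ 2 * exp (3 * x).
Proof.
intros HX Hk D0 D1 D2 PF Pq Pr E0 E1 E2 x Hx.
(* Adding k^2 absorbs the forcing [r]: the weighted energy becomes nonincreasing, with value k^2 at
   0. *)
pose (N := fun x => (e x ^ 2 + e1 x ^ 2 + e2 x ^ 2 + k ^ 2) * exp (- (3 * x))).
assert (H : - N 0 <= - N x).
{ apply (derive_nonneg_le (fun x => - N x) (fun x => -
    ((2 * e x * e1 x + 2 * e1 x * e2 x
      + 2 * e2 x * (- (F x * e2 x) - q x * e x - r x))
     - 3 * (e x ^ 2 + e1 x ^ 2 + e2 x ^ 2 + k ^ 2)) * exp (- (3 * x)))); [lra| |].
  - intros y Hy; unfold N.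
    specialize (D0 y ltac:(lra)); specialize (D1 y ltac:(lra)).
    specialize (D2 y ltac:(lra)).
    auto_derive.
    + repeat split; eexists; eassumption.
    + replace (Derive (fun x => e x) y) with (e1 y)
        by (symmetry; now apply is_derive_unique).
      replace (Derive (fun x => e1 x) y) with (e2 y)
        by (symmetry; now apply is_derive_unique).
      replace (Derive (fun x => e2 x) y) with (- (F y * e2 y) - q y * e y - r y)
        by (symmetry; now apply is_derive_unique).
      ring.
  - intros y Hy.
    specialize (PF y ltac:(lra)); specialize (Pq y ltac:(lra)).
    specialize (Pr y ltac:(lra)).
    apply Rmult_le_pos; [|left; apply exp_pos].
    set (u := e y) in *; set (v := e1 y) in *; set (w := e2 y) in *.
    set (Q := q y) in *; set (s := r y) in *; set (f := F y) in *.
    clearbody u v w Q s f; clear - PF Pq Pr Hk.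
    assert (2 * u * v <= u ^ 2 + v ^ 2) by (pose proof (pow2_ge_0 (u - v)); lra).
    assert (2 * v * w <= v ^ 2 + w ^ 2) by (pose proof (pow2_ge_0 (v - w)); lra).
    assert (0 <= f * w ^ 2) by (apply Rmult_le_pos; [trivial|apply pow2_ge_0]).
    apply Rabs_le_between in Pq; apply Rabs_le_between in Pr.
    assert (0 <= (k - s) * (k + s)) by (apply Rmult_le_pos; lra).
    assert (- (2 * w * s) <= w ^ 2 / 2 + 2 * s ^ 2)
      by (pose proof (pow2_ge_0 (w + 2 * s)); lra).
    (* Young weights 3/2 and 2/3 balance the budget: in total u^2 receives 1 + 33/20, v^2 receives
       2, w^2 receives 1 + 11/15 + 1/2 and k^2 receives 2, all below 3. *)
    assert (- (2 * w * Q * u) <= 11 / 10 * (3 / 2 * u ^ 2 + 2 / 3 * w ^ 2)).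
    { assert (h : 2 * Rabs (w * u) <= 3 / 2 * u ^ 2 + 2 / 3 * w ^ 2).
      { pose proof (pow2_ge_0 (3 / 2 * u - w)).
        pose proof (pow2_ge_0 (3 / 2 * u + w)).
        unfold Rabs; destruct Rcase_abs; lra. }
      assert (- (Q * (w * u)) <= 11 / 10 * Rabs (w * u)).
      { unfold Rabs; destruct Rcase_abs; nra. }
      lra. }
    pose proof (pow2_ge_0 u); pose proof (pow2_ge_0 v).
    pose proof (pow2_ge_0 w); pose proof (pow2_ge_0 k); lra. }
unfold N in H; rewrite E0, E1, E2 in H.
replace (- (3 * 0)) with 0 in H by ring; rewrite exp_0 in H.
rewrite exp_Ropp in H.
pose proof (exp_pos (3 * x)).
assert (e x ^ 2 + e1 x ^ 2 + e2 x ^ 2 + k ^ 2 <= k ^ 2 * exp (3 * x)); [|nra].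
apply Rmult_le_reg_r with (/ exp (3 * x)); [now apply Rinv_0_lt_compat|].
rewrite Rmult_assoc, Rinv_r; lra.
Qed.

(** * The equation in exponential form *)

Lemma antiderivative_exists (f : R -> R) :
  (forall x, continuous f x) ->
  exists g, g 0 = 0 /\ forall x, is_derive g x (f x).
Proof.
intros C; exists (RInt f 0); split; [apply @RInt_point|intros x].
apply is_derive_RInt with 0; [|apply C].
exists (mkposreal 1 Rlt_0_1); intros y _.
apply @RInt_correct, @ex_RInt_continuous; intros; apply C.
Qed.

(** Extending F to negative x by x^2/2, which has the same value and derivatives up to order two at
    0, turns the one-sided derivatives at 0 into ordinary ones. *)
Definition glue (f g : R -> R) (x : R) : R := if Rle_dec 0 x then f x else g x.

Lemma is_derive_glue (F F' g g' : R -> R) :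
  derivative_on (fun x => 0 <= x) F F' -> (forall x, is_derive g x (g' x)) ->
  F 0 = g 0 -> F' 0 = g' 0 ->
  forall x, is_derive (glue F g) x (glue F' g' x).
Proof.
intros HF Hg E E' x; unfold glue at 2; destruct (Rle_dec 0 x) as [h|h].
- destruct h as [h|<-].
  + apply is_derive_ext_loc with F.
    * exists (mkposreal x h); intros y Hy; apply Rabs_def2 in Hy; simpl in Hy.
      unfold minus, plus, opp in Hy; simpl in Hy.
      unfold glue; destruct Rle_dec; trivial; lra.
    * apply is_derive_derivative_on with (1 := HF); [lra|].
      exists (mkposreal x h); intros y Hy; apply Rabs_def2 in Hy; simpl in Hy.
      unfold minus, plus, opp in Hy; simpl in Hy; lra.
  + apply is_derive_Reals; intros e He.
    pose proof (Hg 0) as Dg; apply is_derive_Reals in Dg.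
    destruct (Dg e He) as [d Hd].
    destruct (HF 0 (Rle_refl 0) (fun z => Rabs (z - F' 0) < e)) as [d0 Hd0].
    { exists (mkposreal e He); intros z Hz; exact Hz. }
    exists (mkposreal _ (Rmin_stable_in_posreal d d0)); intros k Nk Hk; simpl in Hk.
    pose proof (Rmin_l d d0); pose proof (Rmin_r d d0).
    unfold glue; destruct (Rle_dec 0 0) as [_|]; [|lra].
    destruct (Rle_dec 0 (0 + k)) as [P|P].
    * assert (B : ball 0 d0 (0 + k)).
      { change (Rabs (0 + k - 0) < d0); replace (0 + k - 0) with k by ring; lra. }
      specialize (Hd0 (0 + k) B ltac:(lra) P).
      now replace (0 + k - 0) with k in Hd0 by ring.
    * rewrite E, E'; apply Hd; [trivial|lra].
- apply is_derive_ext_loc with g; [|apply Hg].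
  exists (mkposreal (- x) ltac:(lra)); intros y Hy; apply Rabs_def2 in Hy.
  unfold minus, plus, opp in Hy; simpl in Hy.
  unfold glue; destruct Rle_dec; trivial; lra.
Qed.

Lemma is_derive_continuous (f : R -> R) (x l : R) :
  is_derive f x l -> continuous f x.
Proof.
intros H; apply @ex_derive_continuous; now exists l.
Qed.

(** The equation says that F'' exp Phi has zero derivative, but only for x > 0, and F'' is not
    assumed continuous at 0. The constant is therefore identified through the derivative of F' at
    0. *)
Lemma blasius_exp (F : R -> R) : blasius_solution F ->
  exists f f1 Phi : R -> R,
    (forall x, 0 <= x -> F x = f x) /\
    (forall x, 0 <= x -> is_derive f x (f1 x)) /\
    (forall x, 0 <= x -> is_derive f1 x (exp (- Phi x))) /\
    (forall x, 0 <= x -> is_derive Phi x (f x)) /\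
    f 0 = 0 /\ f1 0 = 0 /\ Phi 0 = 0.
Proof.
intros (F1 & F2 & F3 & D0 & D1 & D2 & ODE & E0 & E1 & E2).
pose (f := glue F (fun x => x ^ 2 / 2)); pose (f1 := glue F1 (fun x => x)).
assert (Pf : forall x, 0 <= x -> F x = f x).
{ intros x Hx; unfold f, glue; destruct Rle_dec; trivial; lra. }
assert (Df : forall x, is_derive f x (f1 x)).
{ apply is_derive_glue; trivial; [|lra].
  intros x; auto_derive; trivial; field. }
assert (Df1 : forall x, is_derive f1 x (glue F2 (fun _ => 1) x)).
{ apply is_derive_glue; trivial.
  intros x; apply @is_derive_id. }
destruct (antiderivative_exists f) as [Phi [Phi0 DPhi]].
{ intros x; apply is_derive_continuous with (1 := Df x). }
destruct (antiderivative_exists (fun x => exp (- Phi x))) as [K [K0 DK]].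
{ intros x.
  apply is_derive_continuous with (- f x * exp (- Phi x)).
  specialize (DPhi x); auto_derive; [now exists (f x)|].
  replace (Derive (fun x => Phi x) x) with (f x)
    by (symmetry; now apply is_derive_unique); ring. }
pose (C := F2 1 * exp (Phi 1)).
assert (Dc : forall x, 0 < x -> is_derive (fun x => F2 x * exp (Phi x)) x 0).
{ intros x Hx.
  assert (D : is_derive F2 x (F3 x)).
  { apply is_derive_derivative_on with (1 := D2); trivial.
    exists (mkposreal x Hx); intros y Hy; apply Rabs_def2 in Hy; simpl in Hy.
    unfold minus, plus, opp in Hy; simpl in Hy; lra. }
  specialize (DPhi x); auto_derive.
  - split; [now exists (F3 x)|split; [now exists (f x)|trivial]].
  - replace (Derive (fun x => F2 x) x) with (F3 x)
      by (symmetry; now apply is_derive_unique).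
    replace (Derive (fun x => Phi x) x) with (f x)
      by (symmetry; now apply is_derive_unique).
    rewrite <- Pf by lra; specialize (ODE x Hx).
    replace (1 * F3 x * exp (Phi x) + F2 x * (1 * F x * exp (Phi x)))
      with ((F3 x + F x * F2 x) * exp (Phi x)) by ring.
    rewrite ODE; ring. }
assert (F2E : forall x, 0 < x -> F2 x = C * exp (- Phi x)).
{ assert (Cst : forall x y, 0 < x -> x <= y ->
    F2 x * exp (Phi x) = F2 y * exp (Phi y)).
  { intros x y Hx Hy; apply Rle_antisym.
    - apply (derive_nonneg_le (fun x => F2 x * exp (Phi x)) (fun _ => 0)); trivial.
      + intros z Hz; apply Dc; lra.
      + intros; lra.
    - enough (- (F2 x * exp (Phi x)) <= - (F2 y * exp (Phi y))) by lra.
      apply (derive_nonneg_le (fun x => - (F2 x * exp (Phi x))) (fun _ => - 0));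
        trivial.
      + intros z Hz; apply @is_derive_opp, Dc; lra.
      + intros; lra. }
  intros x Hx; rewrite exp_Ropp.
  replace C with (F2 x * exp (Phi x)).
  - field; apply Rgt_not_eq, exp_pos.
  - unfold C; destruct (Rle_dec x 1); [now apply Cst|symmetry; apply Cst; lra]. }
assert (f10 : f1 0 = 0).
{ unfold f1, glue; destruct Rle_dec; trivial; lra. }
assert (F1E : forall x, 0 < x -> f1 x - C * K x = 0).
{ intros x Hx.
  destruct (MVT_cor2 (fun x => f1 x - C * K x)
    (fun x => glue F2 (fun _ => 1) x - C * exp (- Phi x)) 0 x Hx) as [c [Ec Hc]].
  - intros y Hy; apply is_derive_Reals, @is_derive_minus; [apply Df1|].
    apply @is_derive_scal, DK.
  - unfold glue in Ec; destruct (Rle_dec 0 c) as [_|]; [|lra].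
    rewrite F2E, f10, K0 in Ec by lra; lra. }
(* On x > 0, F' equals C K with K the primitive of exp (- Phi), so the right derivative of F' at 0
   is C; it is also F''(0) = 1. *)
assert (C1 : C = 1).
{ assert (D : is_derive (fun x => f1 x - C * K x) 0 (1 - C)).
  { replace (1 - C) with (glue F2 (fun _ => 1) 0 - C * exp (- Phi 0)).
    - apply @is_derive_minus; [apply Df1|apply @is_derive_scal, DK].
    - unfold glue; destruct Rle_dec as [_|]; [|lra].
      rewrite E2, Phi0, Ropp_0, exp_0; ring. }
  apply is_derive_Reals in D.
  destruct (Req_dec (1 - C) 0) as [|N]; [lra|exfalso].
  destruct (D (Rabs (1 - C)) (Rabs_pos_lt _ N)) as [d Hd].
  pose proof (cond_pos d).
  specialize (Hd (d / 2) ltac:(lra) ltac:(rewrite Rabs_pos_eq; lra)).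
  rewrite F1E, f10, K0 in Hd by lra.
  replace ((0 - (0 - C * 0)) / (d / 2) - (1 - C)) with (- (1 - C)) in Hd by (field; lra).
  rewrite Rabs_Ropp in Hd; lra. }
exists f, f1, Phi.
split; [exact Pf|]; split; [intros; apply Df|].
split; [|split; [intros; apply DPhi|]].
- intros x Hx.
  replace (exp (- Phi x)) with (glue F2 (fun _ => 1) x); [apply Df1|].
  unfold glue; destruct Rle_dec as [_|]; [|lra].
  destruct Hx as [Hx|<-].
  + rewrite F2E, C1 by trivial; ring.
  + rewrite E2, Phi0, Ropp_0, exp_0; ring.
- split; [now rewrite <- Pf by lra|now split].
Qed.

(** * Polynomial approximation on [0, 9/2] *)

(* Coefficients in [y = 8 x] of [phi_den] times an approximation of the integral
   of F: interpolation of F'''/x^2 at 35 Chebyshev nodes of [0, 19/4], with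
   coefficients rounded to few significant bits. *)
Definition phi_coef : list Z :=
  [0; 0; 0;
   3533694129556768659166595001485837031654967793751237916243212402585239552;
   0; 0;
   -57514552889909440395084661301267985236375940349562067348909761495040;
   -328794979172404043918791482026062787381089999173193826304;
   1746372596649580262734674268048471475833044321565134553088;
   2451710650356343870079872057011746286466463328559277297400545280;
   5431593883856771346748867396570561254162236063676782084096;
   -4701144349644771913475631651847327558509090270926547714048;
   -120817326228597011330969896365613789926122702939640567955456;
   -1275629049087860375452263296809375991168447963789107658752;
   434963938713863478653649806137584063140961479692797345792;
   -109264193885977107504472076095980499080462476483481305088;
   24499651042108908288771680222919261528228504374666592256;
   -4155413483425788412226536296380518800799340569099763712;
   566623199866101741305420806350689150803707266594766848;
   -61820983796348037940673334247287296685468373445771264;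
   5251281956113196566782836521439293067834519615176704;
   -321253430110022395621990413752708966641101839532032;
   9790675088439276841597224313026551536033376239616;
   598964141605755103441390948482118308575343280128;
   -122274284762650639321247156845530809088883032064;
   11312264839947926523216785002559349232030973952;
   -751817068825378623332528394656880283971747840;
   39414498831349856688736785210180460827639808;
   -1686915399788624750650057600304908741902336;
   59836774165510592582748256358184192573440;
   -1770193163369311915001665863451032944640;
   43726228358706419006075819844758929408;
   -899324977711154046237344314190462976;
   15300439238254003206630556116713472; -213015267095914304590946544648192;
   2387419799929371565598605049856; -21020239351380349470483152896;
   140034625109495694149074944; -663690283293377741589632;
   1994420786548717240128; -2856806390095172138]%Z.

Definition near_den : Z :=
  102345453979735493885523140177878587255842439399596045107200000000000000%Z.

(** Coefficients, in y = 8 x, of [near_den] times [F0_near], where [near_den] clears all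
    denominators; the representation is exact. *)
Definition near_coef : list Z :=
  [0; 0;
   799573859216683545980649532639676462936269057809344102400000000000000; 0;
   -20333535343002916176792694111631539240603122892800000000000000;
   -25998670434274641406512560549876290450104819258023116800000000000;
   -20264282431572987131794430503757859879492092720005120000000000;
   8316915451524369741616004953701280505960985949175808000000000;
   -548431460766998033810015592133718308420062797399808000000000;
   401843845652519347137839422425345031918518282482868600000000;
   -51180977908220932870410588348551810880298801409245888000000;
   4498918661020497074506306750458174445535701700165990400000;
   -290941643019530550442412080608611637833611611318589104000;
   12424986230421117571167561309918370908423208429508160000;
   -325212185669952104750138052956174404072204706009712000;
   4740379746041246450266280015427913974545050524977280;
   -29627373410678330539215069813821245140912827021097]%Z.

(** The factor 6 makes the leading term x^3/6 exact, so the approximation and its first three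
    derivatives take exactly the values 0, 0, 0, 1 at the origin and the energy estimate starts from
    zero error. *)
Definition phi_den : Z := (6 * 2 ^ 250)%Z.

(* [phi_app k] approximates the [k]-th derivative of the integral of F on [0, 9/2]. *)
Definition phi_app (k : nat) (x : R) : R :=
  8 ^ k * peval (Nat.iter k pderiv phi_coef) (8 * x) / IZR phi_den.

Definition near_app (k : nat) (x : R) : R :=
  8 ^ k * peval (Nat.iter k pderiv near_coef) (8 * x) / IZR near_den.

Lemma F0_near_app (x : R) : F0_near x = near_app 0 x.
Proof.
unfold F0_near, P, near_app; cbn [sum_f_R0 nth p_coef Nat.iter nat_rect].
unfold near_coef, near_den; cbn [peval].
rewrite !S_INR; change (INR 0) with 0.
field.
Qed.

Opaque phi_coef near_coef phi_den near_den.

Lemma is_derive_poly_app (l : list Z) (d : Z) (k : nat) (x : R) :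
  is_derive (fun x => 8 ^ k * peval (Nat.iter k pderiv l) (8 * x) / IZR d) x
    (8 ^ S k * peval (Nat.iter (S k) pderiv l) (8 * x) / IZR d).
Proof.
set (p := Nat.iter k pderiv l).
change (Nat.iter (S k) pderiv l) with (pderiv p).
pose proof (is_derive_peval p (8 * x)) as H.
auto_derive; [now eexists; eassumption|].
replace (Derive (fun x => peval p x) (8 * x)) with (peval (pderiv p) (8 * x))
  by (symmetry; now apply is_derive_unique).
simpl; unfold Rdiv; ring.
Qed.

Lemma phi_den_pos : 0 < IZR phi_den.
Proof. apply IZR_lt; vm_compute; reflexivity. Qed.

Lemma near_den_pos : 0 < IZR near_den.
Proof. apply IZR_lt; vm_compute; reflexivity. Qed.

Lemma pbound_ratio (p : list Z) (B D u v : Z) (n : nat) (y : R) :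
  (0 < D)%Z -> (0 < v)%Z -> (0 < n)%nat ->
  (pbound_check p B n && (B * v <=? u * D)%Z)%bool = true ->
  0 <= y <= 2 * INR n -> Rabs (peval p y / IZR D) <= IZR u / IZR v.
Proof.
intros HD Hv Hn C Hy; apply andb_prop in C as [C1 C2].
pose proof (pbound_check_correct p B n y C1 Hy Hn) as H.
apply Z.leb_le, IZR_le in C2; rewrite 2!mult_IZR in C2.
apply IZR_lt in HD; apply IZR_lt in Hv.
rewrite Rabs_div, (Rabs_pos_eq (IZR D)) by lra.
apply Rle_div_l; [lra|].
replace (IZR u / IZR v * IZR D) with (IZR u * IZR D / IZR v) by (field; lra).
apply Rle_div_r; [lra|]; nra.
Qed.

Lemma phi3_bound (x : R) : 0 <= x <= 9 / 2 -> Rabs (phi_app 3 x) <= 11 / 10.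
Proof.
intros Hx; unfold phi_app.
replace (8 ^ 3 * peval (Nat.iter 3 pderiv phi_coef) (8 * x))
  with (peval (pscal 512 (Nat.iter 3 pderiv phi_coef)) (8 * x))
  by (rewrite peval_scal; simpl; ring).
(* For x in [0, 9/2], y = 8 x runs over [0, 36], that is 18 cells of length 2 (10 cells for
   [0, 5/2]). The integer bound is the claimed one times the denominator, rounded down. *)
apply (pbound_ratio _ (11 * phi_den / 10) phi_den 11 10 18);
  [reflexivity|reflexivity|lia| |simpl; lra].
vm_compute; reflexivity.
Qed.

(** The chain rule gives the common factor 8^4 to both terms: 8^4 from the fourth derivative, 8
    times 8^3 from the product. The denominator is [phi_den] squared. *)
Definition residual_coef : list Z :=
  pscal (8 ^ 4)
   (padd (pscal phi_den (Nat.iter 4 pderiv phi_coef))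
         (pmul (Nat.iter 1 pderiv phi_coef) (Nat.iter 3 pderiv phi_coef))).

Lemma residual_bound (x : R) : 0 <= x <= 9 / 2 ->
  Rabs (phi_app 4 x + phi_app 1 x * phi_app 3 x) <= / 10 ^ 10.
Proof.
intros Hx.
replace (phi_app 4 x + phi_app 1 x * phi_app 3 x)
  with (peval residual_coef (8 * x) / IZR (phi_den * phi_den)).
- replace (/ 10 ^ 10) with (IZR 1 / IZR (10 ^ 10)) by (simpl; field).
  apply (pbound_ratio _ (phi_den * phi_den / 10 ^ 10) _ _ _ 18);
    [reflexivity|reflexivity|lia| |simpl; lra].
  vm_cast_no_check (eq_refl true).
- unfold residual_coef, phi_app.
  rewrite peval_scal, peval_add, peval_scal, peval_mul, mult_IZR.
  pose proof phi_den_pos.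
  change (8 ^ 4)%Z with (8 ^ Z.of_nat 4)%Z; rewrite <- pow_IZR.
  field; lra.
Qed.

Definition near_diff (k : nat) : list Z :=
  pscal (8 ^ Z.of_nat k)
   (padd (pscal (8 * near_den) (Nat.iter (S k) pderiv phi_coef))
         (pscal (- phi_den) (Nat.iter k pderiv near_coef))).

Lemma near_diff_eq (k : nat) (x : R) :
  phi_app (S k) x - near_app k x =
  peval (near_diff k) (8 * x) / IZR (phi_den * near_den).
Proof.
unfold near_diff, phi_app, near_app.
rewrite peval_scal, peval_add, 2!peval_scal, opp_IZR, 2!mult_IZR.
rewrite <- pow_IZR; pose proof phi_den_pos; pose proof near_den_pos.
simpl (8 ^ S k); field; lra.
Qed.

Lemma near_diff_bound (k : nat) (x : R) : (k <= 2)%nat -> 0 <= x <= 5 / 2 ->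
  Rabs (phi_app (S k) x - near_app k x) <= 2 / 10 ^ 7.
Proof.
intros Hk Hx; rewrite near_diff_eq.
replace (2 / 10 ^ 7) with (IZR 2 / IZR (10 ^ 7)) by (simpl; field).
apply (pbound_ratio _ (2 * phi_den * near_den / 10 ^ 7) _ _ _ 10);
  [reflexivity|reflexivity|lia| |simpl; lra].
destruct k as [|[|[|k]]]; [| | |lia]; vm_compute; reflexivity.
Qed.

(** * The flow F'' = exp (- Phi) and its distance to the polynomial *)

Definition blasius_flow (f f1 Phi : R -> R) : Prop :=
  (forall x, 0 <= x -> is_derive f x (f1 x)) /\
  (forall x, 0 <= x -> is_derive f1 x (exp (- Phi x))) /\
  (forall x, 0 <= x -> is_derive Phi x (f x)) /\
  f 0 = 0 /\ f1 0 = 0 /\ Phi 0 = 0.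

Lemma flow_f1_incr f f1 Phi : blasius_flow f f1 Phi ->
  forall x y, 0 <= x -> x <= y -> f1 x <= f1 y.
Proof.
intros (_ & D1 & _) x y Hx Hy.
apply (derive_nonneg_le f1 (fun x => exp (- Phi x))); trivial.
- intros z Hz; apply D1; lra.
- intros; left; apply exp_pos.
Qed.

Lemma flow_f_incr f f1 Phi : blasius_flow f f1 Phi ->
  forall x y, 0 <= x -> x <= y -> f x <= f y.
Proof.
intros B x y Hx Hy.
pose proof (flow_f1_incr f f1 Phi B) as M.
destruct B as (D0 & _ & _ & _ & f10 & _).
apply (derive_nonneg_le f f1); trivial.
- intros z Hz; apply D0; lra.
- intros z Hz; rewrite <- f10; apply M; lra.
Qed.

Lemma flow_f_nonneg f f1 Phi : blasius_flow f f1 Phi ->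
  forall x, 0 <= x -> 0 <= f x.
Proof.
intros B x Hx; pose proof (flow_f_incr f f1 Phi B 0 x (Rle_refl 0) Hx) as H.
destruct B as (_ & _ & _ & f0 & _); lra.
Qed.

Lemma phi_app_0 (k : nat) :
  phi_app k 0 = IZR (8 ^ Z.of_nat k * pevalZ (Nat.iter k pderiv phi_coef) 0) / IZR phi_den.
Proof.
unfold phi_app; rewrite Rmult_0_r, peval_IZR, mult_IZR, pow_IZR; reflexivity.
Qed.

Lemma is_derive_phi_app (k : nat) (x : R) :
  is_derive (phi_app k) x (phi_app (S k) x).
Proof. apply is_derive_poly_app. Qed.

Lemma is_derive_near_app (k : nat) (x : R) :
  is_derive (near_app k) x (near_app (S k) x).
Proof. apply is_derive_poly_app. Qed.

Lemma exp_mul_INR (n : nat) (x : R) : exp (INR n * x) = exp x ^ n.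
Proof.
induction n as [|n IH]; [now rewrite Rmult_0_l, exp_0|].
rewrite S_INR; replace ((INR n + 1) * x) with (x + INR n * x) by ring.
now rewrite exp_plus, IH.
Qed.

Lemma Rabs_le_sqr (u k : R) : 0 <= k -> u ^ 2 <= k ^ 2 -> Rabs u <= k.
Proof.
intros Hk H; rewrite <- (Rabs_pos_eq k Hk); apply Rsqr_le_abs_0.
unfold Rsqr; lra.
Qed.

(** The residual 10^-10 is amplified by exp (3 x / 2) with x <= 9/2, hence by less than 3^7 = 2187;
    the product is rounded up. *)
Definition flow_err : R := 25 / 10 ^ 8.

Lemma phi_app_error f f1 Phi : blasius_flow f f1 Phi ->
  forall x, 0 <= x <= 9 / 2 ->
    Rabs (Phi x - phi_app 0 x) <= flow_err * x /\ Rabs (f x - phi_app 1 x) <= flow_err /\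
    Rabs (f1 x - phi_app 2 x) <= flow_err /\ Rabs (exp (- Phi x) - phi_app 3 x) <= flow_err.
Proof.
intros B; pose proof (flow_f_nonneg _ _ _ B) as Pf.
destruct B as (D0 & D1 & D2 & f0 & f10 & P0).
assert (A0 : phi_app 0 0 = 0) by (rewrite phi_app_0; apply Rmult_0_l).
assert (A1 : phi_app 1 0 = 0) by (rewrite phi_app_0; apply Rmult_0_l).
assert (A2 : phi_app 2 0 = 0) by (rewrite phi_app_0; apply Rmult_0_l).
assert (A3 : phi_app 3 0 = 1).
{ rewrite phi_app_0.
  replace (8 ^ Z.of_nat 3 * pevalZ (Nat.iter 3 pderiv phi_coef) 0)%Z with phi_den
    by (vm_compute; reflexivity).
  pose proof phi_den_pos; field; lra. }
assert (En : forall x, 0 <= x <= 9 / 2 ->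
  (f x - phi_app 1 x) ^ 2 + (f1 x - phi_app 2 x) ^ 2
  + (exp (- Phi x) - phi_app 3 x) ^ 2 <= flow_err ^ 2).
{ intros x Hx.
  pose proof (energy_bound f (phi_app 3) (fun x => f x - phi_app 1 x)
    (fun x => f1 x - phi_app 2 x) (fun x => exp (- Phi x) - phi_app 3 x)
    (fun x => phi_app 4 x + phi_app 1 x * phi_app 3 x) (9 / 2) (/ 10 ^ 10)) as H.
  cbv beta in H.
  assert (h : exp (3 * x) <= 3 ^ 14).
  { apply Rle_trans with (exp 1 ^ 14).
    - rewrite <- exp_mul_INR; left; apply exp_increasing; simpl; lra.
    - apply pow_incr; split; [left; apply exp_pos|apply exp_le_3]. }
  apply Rle_trans with ((/ 10 ^ 10) ^ 2 * exp (3 * x)).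
  - apply H; try lra.
    + intros y Hy; apply @is_derive_minus; [apply D0; lra|apply is_derive_phi_app].
    + intros y Hy; apply @is_derive_minus; [apply D1; lra|apply is_derive_phi_app].
    + intros y Hy.
      (* Splitting the difference of the two products this way leaves the true nonnegative [f] as
         damping coefficient and the polynomial [phi_app 3], bounded by 11/10, as coefficient of the
         error. *)
      replace (- (f y * (exp (- Phi y) - phi_app 3 y)) - phi_app 3 y * (f y - phi_app 1 y)
        - (phi_app 4 y + phi_app 1 y * phi_app 3 y))
        with (- f y * exp (- Phi y) - phi_app 4 y) by ring.
      apply @is_derive_minus; [|apply is_derive_phi_app].
      specialize (D2 y ltac:(lra)); auto_derive; [now exists (f y)|].
      replace (Derive (fun x => Phi x) y) with (f y)
        by (symmetry; now apply is_derive_unique); ring.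
    + intros y Hy; apply Pf; lra.
    + intros y Hy; now apply phi3_bound.
    + intros y Hy; now apply residual_bound.
    + rewrite P0, Ropp_0, exp_0; lra.
  - apply Rle_trans with ((/ 10 ^ 10) ^ 2 * 3 ^ 14).
    + apply Rmult_le_compat_l; [lra|trivial].
    + unfold flow_err; lra. }
assert (Ee : 0 < flow_err) by (unfold flow_err; lra).
assert (Ef : forall x, 0 <= x <= 9 / 2 -> Rabs (f x - phi_app 1 x) <= flow_err).
{ intros x Hx; specialize (En x Hx); apply Rabs_le_sqr; [lra|].
  pose proof (pow2_ge_0 (f1 x - phi_app 2 x)).
  pose proof (pow2_ge_0 (exp (- Phi x) - phi_app 3 x)); lra. }
intros x Hx; split; [|split; [now apply Ef|]].
- assert (H : forall s, -1 <= s <= 1 -> s * (Phi x - phi_app 0 x) <= flow_err * x).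
  { intros s Hs.
    enough (s * (Phi x - phi_app 0 x) - s * (Phi 0 - phi_app 0 0) <= flow_err * x - flow_err * 0)
      by (rewrite P0, A0 in *; lra).
    apply (derive_le (fun x => s * (Phi x - phi_app 0 x)) (fun x => flow_err * x)
      (fun x => s * (f x - phi_app 1 x)) (fun _ => flow_err)); [lra| | |].
    - intros y Hy; apply @is_derive_scal, @is_derive_minus;
        [apply D2; lra|apply is_derive_phi_app].
    - intros y Hy; auto_derive; trivial; ring.
    - intros y Hy; specialize (Ef y ltac:(lra)); apply Rabs_le_between in Ef; nra. }
  pose proof (H 1 ltac:(lra)); pose proof (H (-1) ltac:(lra)).
  apply Rabs_le; lra.
- specialize (En x Hx); pose proof (pow2_ge_0 (f x - phi_app 1 x)).
  pose proof (pow2_ge_0 (f1 x - phi_app 2 x)).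
  pose proof (pow2_ge_0 (exp (- Phi x) - phi_app 3 x)).
  split; apply Rabs_le_sqr; lra.
Qed.

Lemma sup_norm_le (D : R -> Prop) (f : R -> R) (B : R) :
  (forall x, D x -> Rabs (f x) <= B) -> Rbar_le (sup_norm_on D f) B.
Proof.
intros H; apply (proj2 (Lub_Rbar_correct _)).
intros r [x [Hx ->]]; apply H; trivial.
Qed.

Lemma near_error F f f1 Phi : (forall x, 0 <= x -> F x = f x) ->
  blasius_flow f f1 Phi -> near_error_bounds F.
Proof.
intros E B; pose proof (phi_app_error _ _ _ B) as He.
destruct B as (D0 & D1 & D2 & f0 & f10 & P0).
(* The sum of the two errors is 4.5 10^-7, below the smallest of the three required bounds, so one
   argument serves all of them. *)
assert (Bd : forall k x g b, (k <= 2)%nat -> 0 <= x <= 5 / 2 -> Rabs (g - phi_app (S k) x) <= flow_err ->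
  35 / 10 ^ 7 <= b -> Rabs (g - near_app k x) <= b).
{ intros k x g b Hk Hx Hg Hb.
  pose proof (near_diff_bound k x Hk Hx) as H.
  replace (g - near_app k x)
    with ((g - phi_app (S k) x) + (phi_app (S k) x - near_app k x)) by ring.
  apply Rle_trans with (1 := Rabs_triang _ _); unfold flow_err in *; lra. }
exists (fun x => f1 x - near_app 1 x), (fun x => exp (- Phi x) - near_app 2 x).
repeat split.
- apply derivative_on_is_derive with (fun x => f x - near_app 0 x).
  + intros x Hx; rewrite E, F0_near_app by lra; trivial.
  + intros x Hx; apply @is_derive_minus; [apply D0; lra|apply is_derive_near_app].
- apply derivative_on_is_derive with (fun x => f1 x - near_app 1 x); trivial.
  intros x Hx; apply @is_derive_minus; [apply D1; lra|apply is_derive_near_app].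
- apply sup_norm_le; intros x Hx.
  apply (Bd 2%nat); [lia|lra|apply He; lra|lra].
- apply sup_norm_le; intros x Hx.
  apply (Bd 1%nat); [lia|lra|apply He; lra|lra].
- apply sup_norm_le; intros x Hx; rewrite E, F0_near_app by lra.
  apply (Bd 0%nat); [lia|lra|apply He; lra|lra].
Qed.

(** * The Gaussian tail *)

Definition gauss_tail (s : R) : R :=
  RInt_gen (fun v => exp (- v ^ 2)) (at_point s) (Rbar_locally p_infty).

(** Trades the improper integral for l minus an ordinary primitive; afterwards only the derivative
    of the tail and its limit 0 are used. Convergence follows from x^2 >= x - 1. *)
Lemma gauss_tail_spec : exists l : R, exists G : R -> R,
  (forall s, gauss_tail s = l - G s) /\
  (forall s, is_derive G s (exp (- s ^ 2))) /\ is_lim G p_infty l.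
Proof.
pose (G := RInt (fun v => exp (- v ^ 2)) 0).
assert (C : forall x, continuous (fun v => exp (- v ^ 2)) x).
{ intros x; apply @ex_derive_continuous; auto_derive; trivial. }
assert (I : forall a b, ex_RInt (fun v => exp (- v ^ 2)) a b).
{ intros a b; apply @ex_RInt_continuous; intros; apply C. }
assert (DG : forall s, is_derive G s (exp (- s ^ 2))).
{ intros s; apply (is_derive_RInt (fun v => exp (- v ^ 2)) G 0); [|apply C].
  exists (mkposreal 1 Rlt_0_1); intros y _; apply @RInt_correct, I. }
destruct (lim_of_exp_decay (fun x => - G x) (fun x => exp (- x ^ 2)) 1 1 1)
  as [l [Ll _]]; [lra| | |].
- intros x _; apply @is_derive_opp, DG.
- intros x Hx; split; [left; apply exp_pos|].
  rewrite 2!Rmult_1_l.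
  left; apply exp_increasing; nra.
- exists (- l), G.
  assert (L : is_lim G p_infty (- l)).
  { apply is_lim_p_infty_eps; intros e He.
    destruct (proj1 (is_lim_p_infty_eps _ _) Ll e He) as [A HA].
    exists A; intros x Hx; specialize (HA x Hx).
    rewrite <- Rabs_Ropp; now replace (- (G x - - l)) with (- G x - l) by ring. }
  split; [|now split].
  intros s; apply is_RInt_gen_unique.
  intros P [e He].
  destruct (proj1 (is_lim_p_infty_eps _ _) L e (cond_pos e)) as [A HA].
  apply (Filter_prod _ _ _ (fun a => a = s) (fun b => A < b)).
  + reflexivity.
  + now exists A.
  + intros a b -> Hb; simpl; exists (RInt (fun v => exp (- v ^ 2)) s b).
    split; [apply @RInt_correct, I|].
    apply He.
    replace (RInt (fun v => exp (- v ^ 2)) s b) with (G b - G s).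
    * specialize (HA b Hb).
      change (Rabs (G b - G s - (- l - G s)) < e).
      now replace (G b - G s - (- l - G s)) with (G b - - l) by ring.
    * unfold G; rewrite <- (RInt_Chasles (fun v => exp (- v ^ 2)) 0 s b) by apply I.
      unfold plus; simpl; ring.
Qed.

Lemma is_derive_gauss_tail (s : R) : is_derive gauss_tail s (- exp (- s ^ 2)).
Proof.
destruct gauss_tail_spec as (l & G & E & D & _).
apply is_derive_ext with (fun s => l - G s); [intros; now rewrite E|].
replace (- exp (- s ^ 2)) with (0 - exp (- s ^ 2)) by ring.
apply @is_derive_minus; [apply @is_derive_const|apply D].
Qed.

Lemma is_lim_gauss_tail : is_lim gauss_tail p_infty 0.
Proof.
destruct gauss_tail_spec as (l & G & E & _ & L).
apply is_lim_ext with (fun s => l - G s); [intros; now rewrite E|].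
replace (Finite 0) with (Finite (l - l)) by (f_equal; ring).
apply is_lim_minus'; [apply is_lim_const|trivial].
Qed.

Lemma is_lim_sqr_gauss : is_lim (fun s => s ^ 2 * exp (- s ^ 2)) p_infty 0.
Proof.
apply is_lim_squeeze0 with (fun s => 4 * exp (- (1 * (s - 0)))) 2.
- intros s Hs; rewrite Rabs_pos_eq.
  (* exp s is the square of exp (s / 2), which is at least s / 2; and s^2 >= 2 s for s >= 2 leaves a
     spare factor exp (- s). *)
  + assert (H : s ^ 2 <= 4 * exp s).
    { replace s with (s / 2 + s / 2) at 2 by field; rewrite exp_plus.
      pose proof (exp_ineq1_le (s / 2)); nra. }
    assert (exp (- s ^ 2) <= exp (- (1 * (s - 0))) * exp (- s)).
    { rewrite <- exp_plus; left; apply exp_increasing; nra. }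
    pose proof (exp_pos (- (1 * (s - 0)))); pose proof (exp_pos (- s)).
    pose proof (pow2_ge_0 s).
    apply Rle_trans with (s ^ 2 * (exp (- (1 * (s - 0))) * exp (- s)));
      [now apply Rmult_le_compat_l|].
    apply Rle_trans with (4 * exp s * (exp (- (1 * (s - 0))) * exp (- s))).
    * apply Rmult_le_compat_r; [|trivial]; apply Rmult_le_pos; lra.
    * right; replace (4 * exp s * (exp (- (1 * (s - 0))) * exp (- s)))
        with (4 * exp (- (1 * (s - 0))) * (exp s * exp (- s))) by ring.
      rewrite <- exp_plus, Rplus_opp_r, exp_0; ring.
  + apply Rmult_le_pos; [apply pow2_ge_0|left; apply exp_pos].
- apply is_lim_scal0, is_lim_exp_decay; lra.
Qed.

Lemma gauss_tail_pos (s : R) : 0 <= gauss_tail s.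
Proof.
apply (decay_nonneg gauss_tail (fun s => - exp (- s ^ 2)) s); [| | |lra].
- intros; apply is_derive_gauss_tail.
- intros x _; pose proof (exp_pos (- x ^ 2)); lra.
- apply is_lim_gauss_tail.
Qed.

Lemma gauss_le_lim0 (f : R -> R) (A C : R) :
  (forall s, A < s -> Rabs (f s) <= C * s ^ 2 * exp (- s ^ 2)) ->
  is_lim f p_infty 0.
Proof.
intros H; apply is_lim_squeeze0 with (fun s => C * (s ^ 2 * exp (- s ^ 2))) A.
- intros s Hs; specialize (H s Hs); lra.
- apply is_lim_scal0, is_lim_sqr_gauss.
Qed.

Lemma gauss_tail_le (s : R) : 1 <= s -> gauss_tail s <= exp (- s ^ 2).
Proof.
apply (decay_le gauss_tail (fun s => exp (- s ^ 2))
  (fun s => - exp (- s ^ 2)) (fun s => - (2 * s) * exp (- s ^ 2))).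
- intros; apply is_derive_gauss_tail.
- intros; auto_derive; trivial; simpl; ring.
- intros x Hx; pose proof (exp_pos (- x ^ 2)); nra.
- apply is_lim_gauss_tail.
- apply (gauss_le_lim0 _ 1 1); intros x Hx.
  rewrite Rabs_pos_eq by (left; apply exp_pos).
  pose proof (exp_pos (- x ^ 2)); assert (1 <= x ^ 2) by nra; nra.
Qed.

(** One integration from infinity of s^(-n) exp (- b s^2) costs a factor 1/(2 b) and gains a power
    of 1/s: differentiating the proposed bound returns minus the integrand and a further term of
    favourable sign. *)
Lemma gauss_decay_bound (f f' : R -> R) (C b a : R) (n : nat) :
  0 < a -> 1 <= b -> 0 <= C ->
  (forall s, a <= s -> is_derive f s (f' s)) ->
  (forall s, a <= s -> - f' s <= C * (/ s) ^ n * exp (- (b * s ^ 2))) ->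
  is_lim f p_infty 0 ->
  forall s, a <= s -> f s <= C / (2 * b) * (/ s) ^ S n * exp (- (b * s ^ 2)).
Proof.
intros Ha Hb HC D H L.
apply (decay_le f (fun s => C / (2 * b) * (/ s) ^ S n * exp (- (b * s ^ 2))) f'
  (fun s => - (C * (/ s) ^ n * exp (- (b * s ^ 2)))
    - C / (2 * b) * INR (S n) * (/ s) ^ (S (S n)) * exp (- (b * s ^ 2)))); trivial.
- intros s Hs; auto_derive; [lra|].
  change (match n with O => 1 | S _ => INR n + 1 end) with (INR (S n)).
  set (N := INR (S n)); clearbody N; simpl; field; lra.
- intros s Hs; specialize (H s Hs).
  enough (0 <= C / (2 * b) * INR (S n) * (/ s) ^ (S (S n)) * exp (- (b * s ^ 2)))
    by lra.
  pose proof (exp_pos (- (b * s ^ 2))).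
  apply Rmult_le_pos; [|lra]; apply Rmult_le_pos;
    [|apply pow_le; left; apply Rinv_0_lt_compat; lra].
  apply Rmult_le_pos; [|apply pos_INR].
  apply Rdiv_le_0_compat; lra.
- apply (gauss_le_lim0 _ (Rmax 1 a) C).
  intros s Hs; pose proof (Rmax_l 1 a); pose proof (Rmax_r 1 a).
  assert (0 < / s <= 1).
  { split; [apply Rinv_0_lt_compat; lra|].
    rewrite <- Rinv_1; apply Rinv_le_contravar; lra. }
  assert (0 <= (/ s) ^ S n <= 1).
  { split; [apply pow_le; lra|].
    rewrite <- (pow1 (S n)); apply pow_incr; lra. }
  pose proof (exp_pos (- (b * s ^ 2))).
  assert (exp (- (b * s ^ 2)) <= exp (- s ^ 2)).
  { destruct (Req_dec b 1) as [->|N]; [right; f_equal; ring|].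
    left; apply exp_increasing.
    assert (0 < (b - 1) * s ^ 2) by (apply Rmult_lt_0_compat; nra); lra. }
  assert (0 <= C / (2 * b) <= C).
  { split; [apply Rdiv_le_0_compat; lra|].
    apply Rle_div_l; [lra|]; nra. }
  rewrite Rabs_pos_eq.
  + assert (C / (2 * b) * (/ s) ^ S n <= C * s ^ 2).
    { apply Rle_trans with (C * 1); [|apply Rmult_le_compat_l; [lra|nra]].
      apply Rmult_le_compat; lra. }
    apply Rmult_le_compat; try lra.
    apply Rmult_le_pos; lra.
  + apply Rmult_le_pos; [|lra]; apply Rmult_le_pos; lra.
Qed.

(* In the variable [s] with [t = s^2], the terms of [F0_far] linear and
   quadratic in [c] are multiples of [gauss_D] and [gauss_k]; the perturbation
   [gauss_H] is their common source: [H' = -2 D], [k'' = 4 exp(-s^2) H]. *)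
Definition gauss_D (s : R) : R := exp (- s ^ 2) - 2 * s * gauss_tail s.

Definition gauss_H (s : R) : R :=
  (1 + 2 * s ^ 2) * gauss_tail s - s * exp (- s ^ 2).

Definition gauss_k (s : R) : R :=
  6 * exp (- s ^ 2) * gauss_tail s - 4 * sqrt 2 * gauss_tail (sqrt 2 * s)
  - 4 * s * gauss_tail s ^ 2.

Definition gauss_k1 (s : R) : R :=
  2 * exp (- (2 * s ^ 2)) - 4 * s * exp (- s ^ 2) * gauss_tail s
  - 4 * gauss_tail s ^ 2.

Lemma Derive_gauss_tail (s : R) :
  Derive (fun s => gauss_tail s) s = - exp (- s ^ 2).
Proof. apply is_derive_unique, is_derive_gauss_tail. Qed.

Lemma ex_derive_gauss_tail (s : R) : ex_derive (fun s => gauss_tail s) s.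
Proof. eexists; apply is_derive_gauss_tail. Qed.

Lemma is_derive_gauss_D (s : R) : is_derive gauss_D s (- (2 * gauss_tail s)).
Proof.
unfold gauss_D; auto_derive.
- apply ex_derive_gauss_tail.
- rewrite Derive_gauss_tail; simpl; ring.
Qed.

Lemma is_derive_gauss_H (s : R) : is_derive gauss_H s (- (2 * gauss_D s)).
Proof.
unfold gauss_H, gauss_D; auto_derive.
- apply ex_derive_gauss_tail.
- rewrite Derive_gauss_tail; simpl; ring.
Qed.

Lemma exp_sqrt2_sqr (s : R) : exp (- (sqrt 2 * s) ^ 2) = exp (- (2 * s ^ 2)).
Proof.
f_equal; rewrite Rpow_mult_distr, pow2_sqrt by lra; trivial.
Qed.

Lemma exp_double (s : R) : exp (- (2 * s ^ 2)) = exp (- s ^ 2) * exp (- s ^ 2).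
Proof. rewrite <- exp_plus; f_equal; ring. Qed.

Lemma is_derive_gauss_k (s : R) : is_derive gauss_k s (gauss_k1 s).
Proof.
assert (h : sqrt 2 * sqrt 2 = 2) by (apply sqrt_sqrt; lra).
unfold gauss_k, gauss_k1; auto_derive.
- repeat split; apply ex_derive_gauss_tail.
- rewrite 2!Derive_gauss_tail, exp_sqrt2_sqr, exp_double.
  replace (s * (s * 1)) with (s ^ 2) by ring.
  set (g := exp (- s ^ 2)); set (T := gauss_tail s); clearbody g T.
  replace (4 * sqrt 2 * (sqrt 2 * 1 * - (g * g))) with (- (4 * (sqrt 2 * sqrt 2) * (g * g)))
    by ring; rewrite h; ring.
Qed.

Lemma is_derive_gauss_k1 (s : R) :
  is_derive gauss_k1 s (4 * exp (- s ^ 2) * gauss_H s).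
Proof.
unfold gauss_k1, gauss_H; auto_derive.
- repeat split; apply ex_derive_gauss_tail.
- rewrite Derive_gauss_tail; replace (s * (s * 1)) with (s ^ 2) by ring.
  rewrite exp_double; ring.
Qed.

Lemma gauss_tail_bounds (s : R) : 1 <= s ->
  0 <= gauss_tail s <= exp (- s ^ 2) /\ exp (- s ^ 2) <= 1 /\
  1 <= s ^ 2 /\ s <= s ^ 2.
Proof.
intros Hs; pose proof (gauss_tail_pos s); pose proof (gauss_tail_le s Hs).
assert (exp (- s ^ 2) <= 1).
{ rewrite <- exp_0; left; apply exp_increasing; nra. }
repeat split; trivial; nra.
Qed.

Lemma is_lim_gauss_D : is_lim gauss_D p_infty 0.
Proof.
apply (gauss_le_lim0 _ 1 3); intros s Hs.
destruct (gauss_tail_bounds s ltac:(lra)) as (T & G & S1 & S2).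
unfold gauss_D; set (g := exp (- s ^ 2)) in *; set (t := gauss_tail s) in *.
assert (0 <= s * t <= s * g) by (split; nra).
assert (s * g <= s ^ 2 * g) by nra.
assert (g <= s ^ 2 * g) by nra.
apply Rabs_le; lra.
Qed.

Lemma is_lim_gauss_H : is_lim gauss_H p_infty 0.
Proof.
apply (gauss_le_lim0 _ 1 4); intros s Hs.
destruct (gauss_tail_bounds s ltac:(lra)) as (T & G & S1 & S2).
unfold gauss_H; set (g := exp (- s ^ 2)) in *; set (t := gauss_tail s) in *.
set (q := s ^ 2) in *; clearbody q g t.
assert (0 <= q * t <= q * g) by (split; nra).
assert (0 <= s * g <= q * g) by (split; nra).
assert (g <= q * g) by nra.
apply Rabs_le; lra.
Qed.

Lemma is_lim_gauss_k1 : is_lim gauss_k1 p_infty 0.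
Proof.
apply (gauss_le_lim0 _ 1 10); intros s Hs.
destruct (gauss_tail_bounds s ltac:(lra)) as (T & G & S1 & S2).
unfold gauss_k1; rewrite exp_double.
set (g := exp (- s ^ 2)) in *; set (t := gauss_tail s) in *.
set (q := s ^ 2) in *; clearbody q g t.
assert (0 <= g * g <= g) by (split; nra).
assert (0 <= g * t <= g) by (split; nra).
assert (0 <= s * (g * t) <= q * g) by (split; nra).
assert (0 <= t ^ 2 <= g) by (split; nra).
assert (g <= q * g) by nra.
apply Rabs_le; lra.
Qed.

Lemma is_lim_gauss_k : is_lim gauss_k p_infty 0.
Proof.
apply (gauss_le_lim0 _ 1 18); intros s Hs.
destruct (gauss_tail_bounds s ltac:(lra)) as (T & G & S1 & S2).
assert (Q : 1 <= sqrt 2 <= 2).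
{ split; [rewrite <- sqrt_1 at 1; apply sqrt_le_1_alt; lra|].
  apply Rsqr_incr_0_var; [|lra]; rewrite Rsqr_sqrt by lra; unfold Rsqr; lra. }
destruct (gauss_tail_bounds (sqrt 2 * s) ltac:(nra)) as (T' & _).
rewrite exp_sqrt2_sqr, exp_double in T'.
unfold gauss_k; set (g := exp (- s ^ 2)) in *; set (t := gauss_tail s) in *.
set (t' := gauss_tail (sqrt 2 * s)) in *; set (r := sqrt 2) in *.
set (q := s ^ 2) in *; clearbody q g t t' r.
assert (0 <= g * g <= g) by (split; nra).
assert (0 <= g * t <= g) by (split; nra).
assert (0 <= t ^ 2 <= g) by (split; nra).
assert (0 <= s * t ^ 2 <= q * g) by (split; nra).
assert (0 <= r * t' <= 2 * g) by (split; nra).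
assert (g <= q * g) by nra.
apply Rabs_le; lra.
Qed.

(** Just below the value 1.4139 of s at x = 5/2, so that it bounds s from below for every (a, b)
    within the computed enclosure. *)
Definition far_s : R := 1413 / 1000.

(** The majorant is minus one half of the derivative of exp (- s^2) / (1 + s^2), so that it
    integrates in closed form to the bound of [gauss_D_upper]. The comparison needs s^4 + s^2 >= 4,
    true from [far_s] on. *)
Lemma gauss_tail_upper (s : R) : far_s <= s ->
  2 * gauss_tail s <= s * (2 + s ^ 2) / (1 + s ^ 2) ^ 2 * exp (- s ^ 2).
Proof.
apply (decay_le (fun s => 2 * gauss_tail s)
  (fun s => s * (2 + s ^ 2) / (1 + s ^ 2) ^ 2 * exp (- s ^ 2))
  (fun s => 2 * - exp (- s ^ 2))
  (fun s => 2 * - exp (- s ^ 2)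
            + (4 - s ^ 2 - s ^ 4) / (1 + s ^ 2) ^ 3 * exp (- s ^ 2))).
- intros; apply @is_derive_scal, is_derive_gauss_tail.
- intros x _; assert (0 < 1 + x ^ 2) by nra.
  auto_derive; [simpl in *; nra|].
  replace (x * (x * 1)) with (x ^ 2) by ring; simpl in *; field; nra.
- intros x Hx; unfold far_s in Hx.
  enough (0 <= (x ^ 2 + x ^ 4 - 4) / (1 + x ^ 2) ^ 3 * exp (- x ^ 2)) by
   (replace ((4 - x ^ 2 - x ^ 4) / (1 + x ^ 2) ^ 3)
     with (- ((x ^ 2 + x ^ 4 - 4) / (1 + x ^ 2) ^ 3)) by (field; nra); lra).
  apply Rmult_le_pos; [|left; apply exp_pos].
  apply Rdiv_le_0_compat; [|apply pow_lt; nra].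
  assert (199 / 100 <= x ^ 2) by nra.
  replace (x ^ 4) with (x ^ 2 * x ^ 2) by ring; nra.
- apply is_lim_scal0, is_lim_gauss_tail.
- apply (gauss_le_lim0 _ 1 1); intros x Hx.
  assert (1 <= x ^ 2 /\ x <= x ^ 2) by (split; nra).
  rewrite Rabs_pos_eq.
  + apply Rmult_le_compat_r; [left; apply exp_pos|].
    apply Rle_div_l; [apply pow_lt; nra|].
    set (q := x ^ 2) in *; clearbody q; nra.
  + apply Rmult_le_pos; [|left; apply exp_pos].
    apply Rdiv_le_0_compat; [nra|apply pow_lt; nra].
Qed.

Lemma gauss_D_upper (s : R) : far_s <= s ->
  2 * gauss_D s <= / (1 + s ^ 2) * exp (- s ^ 2).
Proof.
apply (decay_le (fun s => 2 * gauss_D s)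
  (fun s => / (1 + s ^ 2) * exp (- s ^ 2))
  (fun s => 2 * - (2 * gauss_tail s))
  (fun s => - (2 * (s * (2 + s ^ 2) / (1 + s ^ 2) ^ 2 * exp (- s ^ 2))))).
- intros; apply @is_derive_scal, is_derive_gauss_D.
- intros x _; assert (0 < 1 + x ^ 2) by nra.
  auto_derive; [simpl in *; nra|].
  replace (x * (x * 1)) with (x ^ 2) by ring; simpl in *; field; nra.
- intros x Hx; pose proof (gauss_tail_upper x Hx); lra.
- apply is_lim_scal0, is_lim_gauss_D.
- apply (gauss_le_lim0 _ 1 1); intros x Hx.
  assert (1 <= x ^ 2) by nra.
  assert (0 < / (1 + x ^ 2) <= 1).
  { split; [apply Rinv_0_lt_compat; lra|].
    rewrite <- Rinv_1; apply Rinv_le_contravar; lra. }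
  pose proof (exp_pos (- x ^ 2)).
  rewrite Rabs_pos_eq; [apply Rmult_le_compat_r; lra|].
  apply Rmult_le_pos; lra.
Qed.

(** Comparing derivatives reduces this to s^3 / (1 + s^2)^2 <= 33/100; the maximum of the left side,
    attained at s = sqrt 3, is about 0.3248. *)
Lemma gauss_H_upper (s : R) : far_s <= s ->
  gauss_H s <= 33 / 200 * (/ s) ^ 2 * exp (- s ^ 2).
Proof.
apply (decay_le gauss_H
  (fun s => 33 / 200 * (/ s) ^ 2 * exp (- s ^ 2))
  (fun s => - (2 * gauss_D s))
  (fun s => - (33 / 100 * (1 + s ^ 2) / s ^ 3 * exp (- s ^ 2)))).
- intros; apply is_derive_gauss_H.
- intros x Hx; unfold far_s in Hx; auto_derive; [lra|].
  simpl; field; lra.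
- intros x Hx; pose proof (gauss_D_upper x Hx) as Dx; unfold far_s in Hx.
  enough (/ (1 + x ^ 2) * exp (- x ^ 2) <= 33 / 100 * (1 + x ^ 2) / x ^ 3 * exp (- x ^ 2))
    by lra.
  apply Rmult_le_compat_r; [left; apply exp_pos|].
  assert (0 < x ^ 3) by (apply pow_lt; lra).
  apply Rle_div_r; trivial.
  rewrite Rmult_comm; change (x ^ 3 / (1 + x ^ 2) <= 33 / 100 * (1 + x ^ 2)).
  apply Rle_div_l; [nra|].
  (* This square matches the quartic and cubic terms of (1 + x^2)^2 - 100/33 x^3; what remains is a
     positive quadratic with minimum near 5/4, certified by the other two squares. *)
  pose proof (pow2_ge_0 (x ^ 2 - 150 / 99 * x - 3 / 8)).
  pose proof (pow2_ge_0 (x - 5 / 4)); pose proof (pow2_ge_0 (x - 4 / 3)).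
  simpl in *; lra.
- apply is_lim_gauss_H.
- apply (gauss_le_lim0 _ 1 1); intros x Hx.
  assert (1 <= x ^ 2) by nra.
  assert (0 < / x <= 1).
  { split; [apply Rinv_0_lt_compat; lra|].
    rewrite <- Rinv_1; apply Rinv_le_contravar; lra. }
  pose proof (exp_pos (- x ^ 2)).
  rewrite Rabs_pos_eq; [apply Rmult_le_compat_r; nra|].
  apply Rmult_le_pos; nra.
Qed.

(** * The perturbation equation *)

Lemma gauss_D_nonneg (s : R) : 0 <= gauss_D s.
Proof.
apply (decay_nonneg gauss_D (fun s => - (2 * gauss_tail s)) s); [| | |lra].
- intros; apply is_derive_gauss_D.
- intros x _; pose proof (gauss_tail_pos x); lra.
- apply is_lim_gauss_D.
Qed.

Lemma gauss_H_nonneg (s : R) : 0 <= gauss_H s.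
Proof.
apply (decay_nonneg gauss_H (fun s => - (2 * gauss_D s)) s); [| | |lra].
- intros; apply is_derive_gauss_H.
- intros x _; pose proof (gauss_D_nonneg x); lra.
- apply is_lim_gauss_H.
Qed.

Lemma exp_sub_1_le (v : R) : exp v - 1 <= v * exp v.
Proof.
pose proof (exp_ineq1_le (- v)) as H; pose proof (exp_pos v).
assert (exp v * (1 + - v) <= exp v * exp (- v)) by (apply Rmult_le_compat_l; lra).
rewrite <- exp_plus, Rplus_opp_r, exp_0 in H1; lra.
Qed.

Lemma exp_second_order (v : R) : 0 <= v -> exp v - 1 - v <= v ^ 2 * exp v / 2.
Proof.
intros Hv.
enough (0 <= v ^ 2 * exp v / 2 - (exp v - 1 - v)) by lra.
replace 0 with (0 ^ 2 * exp 0 / 2 - (exp 0 - 1 - 0)) by (rewrite exp_0; field).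
apply (derive_nonneg_le (fun v => v ^ 2 * exp v / 2 - (exp v - 1 - v))
  (fun v => v ^ 2 * exp v / 2 + (v * exp v - (exp v - 1)))); trivial.
- intros x _; auto_derive; trivial; field.
- intros x _; pose proof (exp_sub_1_le x); pose proof (exp_pos x).
  assert (0 <= x ^ 2 * exp x) by (apply Rmult_le_pos; [apply pow2_ge_0|lra]); lra.
Qed.

Lemma is_lim_opp0 (f : R -> R) :
  is_lim f p_infty 0 -> is_lim (fun x => - f x) p_infty 0.
Proof.
intros H; apply is_lim_ext with (fun x => -1 * f x); [intros; ring|].
now apply is_lim_scal0.
Qed.

Section FarPerturbation.

Variables (c : R) (V V1 V2 : R -> R).
Hypothesis c_pos : 0 < c.
Hypothesis c_le : c <= 2338 / 10000.
Hypothesis DV : forall s, far_s <= s -> is_derive V s (V1 s).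
Hypothesis DV1 : forall s, far_s <= s -> is_derive V1 s (V2 s).
Hypothesis DV2 : forall s, far_s <= s ->
  is_derive V2 s (- (4 * c * exp (- s ^ 2) * exp (V s))).
Hypothesis LV : is_lim V p_infty 0.
Hypothesis LV1 : is_lim V1 p_infty 0.
Hypothesis LV2 : is_lim V2 p_infty 0.
Hypothesis V_le : forall s, far_s <= s -> exp (V s) <= 103 / 100.

Lemma pert_nonneg (s : R) : far_s <= s -> 0 <= V s.
Proof.
apply (decay_nonneg V V1); trivial.
intros x Hx; enough (0 <= - V1 x) by lra; revert x Hx.
apply (decay_nonneg (fun x => - V1 x) (fun x => - V2 x)).
- intros x Hx; apply @is_derive_opp; auto.
- intros x Hx; enough (0 <= V2 x) by lra; revert x Hx.
  apply (decay_nonneg V2 (fun s => - (4 * c * exp (- s ^ 2) * exp (V s)))); trivial.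
  intros x _; pose proof (exp_pos (- x ^ 2)); pose proof (exp_pos (V x)).
  enough (0 <= 4 * c * exp (- x ^ 2) * exp (V x)) by lra.
  apply Rmult_le_pos; [apply Rmult_le_pos|]; lra.
- now apply is_lim_opp0.
Qed.

(** As V >= 0, the source of V dominates 4 c exp (- s^2), the source of c H; three integrations from
    infinity preserve the order. The upper bound below is the same argument with exp V <=
    103/100. *)
Lemma pert_lower (s : R) : far_s <= s -> c * gauss_H s <= V s.
Proof.
apply (decay_le (fun s => c * gauss_H s) V (fun s => c * - (2 * gauss_D s)) V1); trivial.
- intros x _; apply @is_derive_scal, is_derive_gauss_H.
- intros x Hx; enough (2 * c * gauss_D x <= - V1 x) by lra; revert x Hx.
  apply (decay_le (fun s => 2 * c * gauss_D s) (fun x => - V1 x)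
    (fun s => 2 * c * - (2 * gauss_tail s)) (fun x => - V2 x)).
  + intros x _; apply @is_derive_scal, is_derive_gauss_D.
  + intros x Hx; apply @is_derive_opp; auto.
  + intros x Hx; enough (4 * c * gauss_tail x <= V2 x) by lra; revert x Hx.
    apply (decay_le (fun s => 4 * c * gauss_tail s) V2
      (fun s => 4 * c * - exp (- s ^ 2))
      (fun s => - (4 * c * exp (- s ^ 2) * exp (V s)))); trivial.
    * intros x _; apply @is_derive_scal, is_derive_gauss_tail.
    * intros x Hx; pose proof (pert_nonneg x Hx).
      pose proof (exp_ineq1_le (V x)); pose proof (exp_pos (- x ^ 2)).
      assert (0 <= c * exp (- x ^ 2)) by nra; nra.
    * apply is_lim_scal0, is_lim_gauss_tail.
  + apply is_lim_scal0, is_lim_gauss_D.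
  + now apply is_lim_opp0.
- apply is_lim_scal0, is_lim_gauss_H.
Qed.

Lemma pert_upper (s : R) : far_s <= s -> V s <= 103 / 100 * c * gauss_H s.
Proof.
apply (decay_le V (fun s => 103 / 100 * c * gauss_H s) V1
  (fun s => 103 / 100 * c * - (2 * gauss_D s))); trivial.
- intros x _; apply @is_derive_scal, is_derive_gauss_H.
- intros x Hx; enough (- V1 x <= 103 / 50 * c * gauss_D x) by lra; revert x Hx.
  apply (decay_le (fun x => - V1 x) (fun s => 103 / 50 * c * gauss_D s) (fun x => - V2 x)
    (fun s => 103 / 50 * c * - (2 * gauss_tail s))).
  + intros x Hx; apply @is_derive_opp; auto.
  + intros x _; apply @is_derive_scal, is_derive_gauss_D.
  + intros x Hx; enough (V2 x <= 103 / 25 * c * gauss_tail x) by lra; revert x Hx.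
    apply (decay_le V2 (fun s => 103 / 25 * c * gauss_tail s)
      (fun s => - (4 * c * exp (- s ^ 2) * exp (V s)))
      (fun s => 103 / 25 * c * - exp (- s ^ 2))); trivial.
    * intros x _; apply @is_derive_scal, is_derive_gauss_tail.
    * intros x Hx; pose proof (V_le x Hx); pose proof (exp_pos (- x ^ 2)).
      assert (0 <= c * exp (- x ^ 2)) by nra; nra.
    * apply is_lim_scal0, is_lim_gauss_tail.
  + now apply is_lim_opp0.
  + apply is_lim_scal0, is_lim_gauss_D.
- apply is_lim_scal0, is_lim_gauss_H.
Qed.

Lemma far_s_pos (s : R) : far_s <= s -> 0 < s /\ 0 < / s <= 1000 / 1413.
Proof.
unfold far_s; intros Hs; split; [lra|split; [apply Rinv_0_lt_compat; lra|]].
replace (1000 / 1413) with (/ (1413 / 1000)) by field.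
apply Rinv_le_contravar; lra.
Qed.

(** The third derivative of V - c H is - 4 c exp (- s^2) (exp V - 1), and exp V - 1 <= V exp V is
    already of order c exp (- s^2) / s^2. Three integrations with weight exp (- 2 s^2) divide by 4^3
    and gain s^(-3). *)
Lemma pert_second (s : R) : far_s <= s ->
  V s - c * gauss_H s <=
  c ^ 2 * (11 / 1000) * (/ s) ^ 5 * exp (- (2 * s ^ 2)).
Proof.
(* 4 (103/100)^2 (33/200) is about 0.7002; it is rounded up to 0.704 so that division by 64 gives
   11/1000. *)
set (C := c ^ 2 * (704 / 1000)).
assert (HC : 0 <= C) by (unfold C; nra).
assert (H2 : forall x, far_s <= x -> V2 x - 4 * c * gauss_tail x <=
  C / (2 * 2) * (/ x) ^ 3 * exp (- (2 * x ^ 2))).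
{ apply (gauss_decay_bound (fun x => V2 x - 4 * c * gauss_tail x)
    (fun s => - (4 * c * exp (- s ^ 2) * exp (V s)) - 4 * c * - exp (- s ^ 2)));
    trivial; try (unfold far_s; lra).
  - intros x Hx; apply @is_derive_minus; [auto|].
    apply @is_derive_scal, is_derive_gauss_tail.
  - intros x Hx.
    pose proof (pert_upper x Hx); pose proof (pert_nonneg x Hx).
    pose proof (gauss_H_upper x Hx); pose proof (gauss_H_nonneg x).
    pose proof (exp_sub_1_le (V x)); pose proof (V_le x Hx).
    destruct (far_s_pos x Hx) as [P1 P2].
    rewrite exp_double; pose proof (exp_pos (- x ^ 2)).
    set (g := exp (- x ^ 2)) in *; set (p := (/ x) ^ 2) in *.
    assert (0 <= p) by (apply pow2_ge_0).
    assert (exp (V x) - 1 <= 103 / 100 * (103 / 100 * c * (33 / 200 * p * g))).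
    { apply Rle_trans with (1 := H3).
      rewrite Rmult_comm; apply Rmult_le_compat; try lra.
      - left; apply exp_pos.
      - apply Rle_trans with (1 := H); apply Rmult_le_compat_l; lra. }
    replace (- (- (4 * c * g * exp (V x)) - 4 * c * - g))
      with (4 * c * g * (exp (V x) - 1)) by ring.
    apply Rle_trans with (4 * c * g * (103 / 100 * (103 / 100 * c * (33 / 200 * p * g)))).
    + apply Rmult_le_compat_l; trivial; apply Rmult_le_pos; lra.
    + unfold C; assert (0 <= c ^ 2 * p * (g * g)); [|lra].
      repeat apply Rmult_le_pos; try lra; apply pow2_ge_0.
  - apply is_lim_ext with (fun x => V2 x + -1 * (4 * c * gauss_tail x)); [intros; ring|].
    apply is_lim_plus0; [trivial|apply is_lim_scal0, is_lim_scal0, is_lim_gauss_tail]. }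
assert (H1 : forall x, far_s <= x -> - V1 x - 2 * c * gauss_D x <=
  C / (2 * 2) / (2 * 2) * (/ x) ^ 4 * exp (- (2 * x ^ 2))).
{ apply (gauss_decay_bound (fun x => - V1 x - 2 * c * gauss_D x)
    (fun s => - V2 s - 2 * c * - (2 * gauss_tail s))); try (unfold far_s; lra).
  - intros x Hx; apply @is_derive_minus; [apply @is_derive_opp; auto|].
    apply @is_derive_scal, is_derive_gauss_D.
  - intros x Hx; specialize (H2 x Hx); lra.
  - apply is_lim_ext with (fun x => -1 * V1 x + -1 * (2 * c * gauss_D x)); [intros; ring|].
    apply is_lim_plus0; [now apply is_lim_scal0|].
    apply is_lim_scal0, is_lim_scal0, is_lim_gauss_D. }
intros Hs; replace (c ^ 2 * (11 / 1000)) with (C / (2 * 2) / (2 * 2) / (2 * 2))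
  by (unfold C; field).
revert s Hs; apply (gauss_decay_bound (fun x => V x - c * gauss_H x)
    (fun s => V1 s - c * - (2 * gauss_D s))); try (unfold far_s; lra).
- intros x Hx; apply @is_derive_minus; [auto|].
  apply @is_derive_scal, is_derive_gauss_H.
- intros x Hx; specialize (H1 x Hx); lra.
- apply is_lim_ext with (fun x => V x + -1 * (c * gauss_H x)); [intros; ring|].
  apply is_lim_plus0; [trivial|apply is_lim_scal0, is_lim_scal0, is_lim_gauss_H].
Qed.

(** * The error left by the second iterate *)

Definition far_e2 (s : R) : R :=
  4 * c * exp (- s ^ 2) * (exp (V s) - 1 - c * gauss_H s).

Definition far_e1 (s : R) : R :=
  - V2 s + 4 * c * gauss_tail s - c ^ 2 * gauss_k1 s.

(** In the application this is F - F0 divided by sqrt (a / 2), as a function of s; [far_e1] and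
    [far_e2] are its derivatives. *)
Definition far_e (s : R) : R :=
  - V1 s - 2 * c * gauss_D s - c ^ 2 * gauss_k s.

Lemma is_derive_far_e (s : R) : far_s <= s -> is_derive far_e s (far_e1 s).
Proof.
intros Hs; unfold far_e.
replace (far_e1 s) with (- V2 s - 2 * c * - (2 * gauss_tail s) - c ^ 2 * gauss_k1 s)
  by (unfold far_e1; ring).
apply @is_derive_minus; [apply @is_derive_minus|].
- now apply @is_derive_opp, DV1.
- apply @is_derive_scal, is_derive_gauss_D.
- apply @is_derive_scal, is_derive_gauss_k.
Qed.

Lemma is_derive_far_e1 (s : R) : far_s <= s -> is_derive far_e1 s (far_e2 s).
Proof.
intros Hs; unfold far_e1.
replace (far_e2 s) with (- - (4 * c * exp (- s ^ 2) * exp (V s))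
  + 4 * c * - exp (- s ^ 2) - c ^ 2 * (4 * exp (- s ^ 2) * gauss_H s))
  by (unfold far_e2; ring).
apply @is_derive_minus; [apply @is_derive_plus|].
- now apply @is_derive_opp, DV2.
- apply @is_derive_scal, is_derive_gauss_tail.
- apply @is_derive_scal, is_derive_gauss_k1.
Qed.

(** exp V - 1 - c H splits as (V - c H) + (exp V - 1 - V), both nonnegative and of order exp (- 2
    s^2). *)
Lemma far_e2_bound (s : R) : far_s <= s ->
  0 <= far_e2 s <= 6 / 10 ^ 4 * (/ s) ^ 2 * exp (- (3 * s ^ 2)).
Proof.
intros Hs; unfold far_e2.
pose proof (pert_lower s Hs) as HL; pose proof (pert_upper s Hs) as HU.
pose proof (pert_second s Hs) as HS; pose proof (pert_nonneg s Hs) as HV.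
pose proof (gauss_H_upper s Hs) as HH; pose proof (gauss_H_nonneg s) as HH0.
pose proof (exp_second_order (V s) HV) as HE; pose proof (V_le s Hs) as Hm.
pose proof (exp_ineq1_le (V s)); pose proof (exp_pos (- s ^ 2)) as Hg.
pose proof (exp_pos (V s)).
destruct (far_s_pos s Hs) as [_ Hi].
rewrite exp_double in HS.
replace (exp (- (3 * s ^ 2))) with (exp (- s ^ 2) * (exp (- s ^ 2) * exp (- s ^ 2)))
  by (rewrite <- 2!exp_plus; f_equal; ring).
set (g := exp (- s ^ 2)) in *; set (i := / s) in *.
split.
- apply Rmult_le_pos; [apply Rmult_le_pos; lra|lra].
- assert (Hc2 : c ^ 2 <= 5467 / 100000) by nra.
  assert (HVu : V s <= 103 / 100 * c * (33 / 200 * i ^ 2 * g)).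
  { apply Rle_trans with (1 := HU); apply Rmult_le_compat_l; lra. }
  assert (HV2 : V s ^ 2 * exp (V s)
     <= (103 / 100 * c * (33 / 200 * i ^ 2 * g)) ^ 2 * (103 / 100)).
  { apply Rmult_le_compat; [apply pow2_ge_0|lra| |lra].
    now apply pow_incr. }
  assert (Hi2 : 0 <= i ^ 2 <= 501 / 1000) by (split; [apply pow2_ge_0|nra]).
  assert (Hi3 : i ^ 3 <= 3546 / 10000).
  { replace (i ^ 3) with (i * i ^ 2) by ring.
    apply Rle_trans with (1000 / 1413 * (501 / 1000)); [|lra].
    apply Rmult_le_compat; lra. }
  (* The first term comes from [pert_second]; in the second, 0.014876 bounds (103/100)^3 (33/200)^2
     / 2, from V^2 exp V / 2. *)
  set (A := c ^ 2 * (11 / 1000) * i ^ 5 + c ^ 2 * (14876 / 10 ^ 6) * i ^ 4).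
  assert (Hb : exp (V s) - 1 - c * gauss_H s <= A * (g * g)).
  { assert (0 <= c ^ 2 * i ^ 4 * (g * g)).
    { repeat apply Rmult_le_pos; try lra; apply pow_le; lra. }
    unfold A; lra. }
  assert (HA : 4 * c * A <= 6 / 10 ^ 4 * i ^ 2).
  { assert (HA' : A <= 5467 / 100000 * (11354 / 10 ^ 6) * i ^ 2).
    { replace A with (c ^ 2 * ((11 / 1000 * i ^ 3 + 14876 / 10 ^ 6 * i ^ 2) * i ^ 2))
        by (unfold A; ring).
      rewrite Rmult_assoc; apply Rmult_le_compat; [apply pow2_ge_0| |trivial|].
      - apply Rmult_le_pos; [|lra].
        assert (0 <= i ^ 3) by (apply pow_le; lra); lra.
      - apply Rmult_le_compat_r; lra. }
    apply Rle_trans with (4 * c * (5467 / 100000 * (11354 / 10 ^ 6) * i ^ 2)).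
    - apply Rmult_le_compat_l; lra.
    - assert (c * i ^ 2 <= 2338 / 10000 * i ^ 2) by (apply Rmult_le_compat_r; lra).
      lra. }
  apply Rle_trans with (4 * c * g * (A * (g * g))).
  + apply Rmult_le_compat_l; trivial; apply Rmult_le_pos; lra.
  + replace (4 * c * g * (A * (g * g))) with (4 * c * A * (g * (g * g))) by ring.
    apply Rmult_le_compat_r; trivial; repeat apply Rmult_le_pos; lra.
Qed.

Lemma far_e1_bound (s : R) : far_s <= s ->
  0 <= - far_e1 s <= 1 / 10 ^ 4 * (/ s) ^ 3 * exp (- (3 * s ^ 2)).
Proof.
assert (L : is_lim (fun s => - far_e1 s) p_infty 0).
{ apply is_lim_ext with (fun s => V2 s + -4 * c * gauss_tail s + c ^ 2 * gauss_k1 s).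
  - intros x; unfold far_e1; ring.
  - apply is_lim_plus0; [apply is_lim_plus0|apply is_lim_scal0, is_lim_gauss_k1];
      trivial; apply is_lim_scal0, is_lim_gauss_tail. }
assert (D : forall s, far_s <= s -> is_derive (fun s => - far_e1 s) s (- far_e2 s)).
{ intros x Hx; now apply @is_derive_opp, is_derive_far_e1. }
intros Hs; split; revert s Hs.
- apply (decay_nonneg (fun s => - far_e1 s) (fun s => - far_e2 s)); trivial.
  intros x Hx; pose proof (far_e2_bound x Hx); lra.
(* Integration against exp (- 3 s^2) divides by 6, here and again for [far_e]. *)
- replace (1 / 10 ^ 4) with (6 / 10 ^ 4 / (2 * 3)) by field.
  apply (gauss_decay_bound (fun s => - far_e1 s) (fun s => - far_e2 s)); trivial;
    try (unfold far_s; lra).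
  intros x Hx; pose proof (far_e2_bound x Hx); lra.
Qed.

Lemma far_e_bound (s : R) : far_s <= s ->
  0 <= far_e s <= 1 / 60000 * (/ s) ^ 4 * exp (- (3 * s ^ 2)).
Proof.
assert (L : is_lim far_e p_infty 0).
{ apply is_lim_ext with (fun s => -1 * V1 s + -2 * c * gauss_D s + - c ^ 2 * gauss_k s).
  - intros x; unfold far_e; ring.
  - apply is_lim_plus0; [apply is_lim_plus0|]; apply is_lim_scal0; trivial.
    + apply is_lim_gauss_D.
    + apply is_lim_gauss_k. }
intros Hs; split; revert s Hs.
- apply (decay_nonneg far_e far_e1); trivial.
  + exact is_derive_far_e.
  + intros x Hx; pose proof (far_e1_bound x Hx); lra.
- replace (1 / 60000) with (1 / 10 ^ 4 / (2 * 3)) by field.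
  apply (gauss_decay_bound far_e far_e1); trivial; try (unfold far_s; lra).
  + exact is_derive_far_e.
  + intros x Hx; pose proof (far_e1_bound x Hx); lra.
Qed.

End FarPerturbation.

(** * Limits at infinity *)

(** The points 5/2 and 9/2 become the integers 20 and 36 in y = 8 x, so values there are enclosed by
    exact integer arithmetic. *)
Lemma phi_app_at (k : nat) (y lo hi v : Z) :
  (0 < v)%Z ->
  (let w := 8 ^ Z.of_nat k * pevalZ (Nat.iter k pderiv phi_coef) y * v in
   (lo * phi_den <=? w) && (w <=? hi * phi_den))%Z%bool = true ->
  IZR lo / IZR v <= phi_app k (IZR y / 8) <= IZR hi / IZR v.
Proof.
intros Hv H; apply andb_prop in H as [H1 H2].
apply Z.leb_le, IZR_le in H1; apply Z.leb_le, IZR_le in H2.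
apply IZR_lt in Hv; pose proof phi_den_pos.
unfold phi_app; replace (8 * (IZR y / 8)) with (IZR y) by field.
rewrite peval_IZR, pow_IZR, <- mult_IZR.
rewrite 2!mult_IZR in H1, H2; rewrite mult_IZR in H1, H2.
rewrite mult_IZR.
set (w := IZR (8 ^ Z.of_nat k) * IZR (pevalZ (Nat.iter k pderiv phi_coef) y)) in *.
clearbody w; split.
- apply Rle_div_l; [lra|]; apply Rle_trans with (w * IZR v / IZR phi_den);
    [apply Rle_div_r; lra|right; field; lra].
- apply Rle_div_l; [lra|]; replace (IZR hi / IZR v * IZR phi_den)
    with (IZR hi * IZR phi_den / IZR v) by (field; lra); apply Rle_div_r; lra.
Qed.

Section Numerics.

Variables f f1 Phi : R -> R.
Hypothesis flow : blasius_flow f f1 Phi.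

Lemma flow_at_52 : 25815 / 10 ^ 4 <= f (5 / 2) <= 25817 / 10 ^ 4.
Proof.
destruct (phi_app_error f f1 Phi flow (5 / 2) ltac:(lra)) as (_ & E & _ & _).
pose proof (phi_app_at 1 20 25816021 25816023 (10 ^ 7) eq_refl) as H.
specialize (H ltac:(vm_compute; reflexivity)).
replace (IZR 20 / 8) with (5 / 2) in H by field.
apply Rabs_le_between in E; unfold flow_err in E; simpl in H; lra.
Qed.

Lemma flow_at_92 :
  58829174 / 10 ^ 7 <= f (9 / 2) <= 58829181 / 10 ^ 7 /\
  16551868 / 10 ^ 7 <= f1 (9 / 2) <= 16551874 / 10 ^ 7 /\
  exp (- Phi (9 / 2)) <= 21 / 10 ^ 6 /\
  108057526 / 10 ^ 7 <= Phi (9 / 2) <= 108057551 / 10 ^ 7.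
Proof.
destruct (phi_app_error f f1 Phi flow (9 / 2) ltac:(lra)) as (E0 & E1 & E2 & E3).
pose proof (phi_app_at 0 36 10805753800 10805753900 (10 ^ 9) eq_refl) as H0.
specialize (H0 ltac:(vm_compute; reflexivity)).
pose proof (phi_app_at 1 36 5882917700 5882917800 (10 ^ 9) eq_refl) as H1.
specialize (H1 ltac:(vm_compute; reflexivity)).
pose proof (phi_app_at 2 36 1655187050 1655187100 (10 ^ 9) eq_refl) as H2.
specialize (H2 ltac:(vm_compute; reflexivity)).
pose proof (phi_app_at 3 36 20282 20283 (10 ^ 9) eq_refl) as H3.
specialize (H3 ltac:(vm_compute; reflexivity)).
replace (IZR 36 / 8) with (9 / 2) in * by field.
apply Rabs_le_between in E0; apply Rabs_le_between in E1.
apply Rabs_le_between in E2; apply Rabs_le_between in E3.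
unfold flow_err in *; simpl in *; lra.
Qed.

(** F is nondecreasing, hence the slope of Phi stays above F(9/2) > 5.8. *)
Lemma flow_tail_bound (x : R) : 9 / 2 <= x ->
  exp (- Phi x) <= 21 / 10 ^ 6 * exp (- (58 / 10 * (x - 9 / 2))).
Proof.
intros Hx; destruct flow_at_92 as (Hf & _ & Hm & _).
pose proof (flow_f_incr _ _ _ flow) as M.
assert (H : 58 / 10 * x - 58 / 10 * (9 / 2) <= Phi x - Phi (9 / 2)).
{ destruct flow as (_ & _ & D & _).
  apply (derive_le (fun x => 58 / 10 * x) Phi (fun _ => 58 / 10) f); trivial.
  - intros; auto_derive; trivial; ring.
  - intros z Hz; apply D; lra.
  - intros z Hz; specialize (M (9 / 2) z ltac:(lra) ltac:(lra)); lra. }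
apply Rle_trans with (exp (- Phi (9 / 2)) * exp (- (58 / 10 * (x - 9 / 2)))).
- rewrite <- exp_plus.
  destruct (Rle_lt_or_eq_dec _ _ H) as [h|h]; [left; apply exp_increasing; lra|].
  right; f_equal; lra.
- apply Rmult_le_compat_r; [left; apply exp_pos|trivial].
Qed.

(* [363 / 10 ^ 8], [63 / 10 ^ 8] and [12 / 10 ^ 8] bound [m / k], [m / k ^ 2] and
   [m / k ^ 3], with [m = 21 / 10 ^ 6] and [k = 58 / 10] from [flow_tail_bound],
   obtained by integrating that bound repeatedly from infinity. *)
Lemma flow_limits : exists a b l : R,
  0 < a /\
  is_lim f1 p_infty a /\ is_lim (fun x => f x - a * x) p_infty b /\
  is_lim (fun x => (a * x + b) ^ 2 / (2 * a) - Phi x) p_infty l /\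
  (forall x, 0 <= x -> f1 x <= a) /\
  f1 (9 / 2) <= a <= f1 (9 / 2) + 363 / 10 ^ 8 /\
  (forall x, 0 <= x -> b <= f x - a * x) /\
  f (9 / 2) - a * (9 / 2) <= b + 63 / 10 ^ 8 /\
  l <= (a * (9 / 2) + b) ^ 2 / (2 * a) - Phi (9 / 2) <= l + 12 / 10 ^ 8.
Proof.
destruct flow_at_92 as (Hf & Hf1 & Hm & HP).
pose proof (flow_f1_incr _ _ _ flow) as M1.
pose proof flow_tail_bound as T.
destruct flow as (D0 & D1 & D2 & _).
assert (E0 : exp (- (58 / 10 * (9 / 2 - 9 / 2))) = 1)
  by (rewrite <- exp_0; f_equal; ring).
destruct (lim_of_exp_decay (fun x => - f1 x) (fun x => exp (- Phi x)) (9 / 2)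
  (21 / 10 ^ 6 / (58 / 10)) (58 / 10)) as [a' [La Ha]]; [lra| | |].
{ intros x Hx; apply @is_derive_opp, D1; lra. }
{ intros x Hx; split; [left; apply exp_pos|specialize (T x Hx); lra]. }
pose (a := - a').
assert (La' : is_lim f1 p_infty a).
{ apply is_lim_ext with (fun x => - - f1 x); [intros; ring|].
  now apply is_lim_opp with (l := Finite a'). }
(* The decay estimate speaks of x >= 9/2 only; monotonicity carries the bound back to smaller x. *)
assert (Ha' : forall x, 0 <= x -> f1 x <= a).
{ intros x Hx; pose proof (Rmax_l x (9 / 2)); pose proof (Rmax_r x (9 / 2)).
  specialize (M1 x (Rmax x (9 / 2)) Hx ltac:(lra)).
  specialize (Ha (Rmax x (9 / 2)) ltac:(lra)); unfold a; lra. }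
pose proof (Ha (9 / 2) ltac:(lra)) as HaX; rewrite E0 in HaX.
assert (a_pos : 0 < a) by (unfold a; lra).
assert (Dl : forall x, 0 <= x -> is_derive (fun x => f x - a * x) x (- (a - f1 x))).
{ intros x Hx; replace (- (a - f1 x)) with (f1 x - a * 1) by ring.
  apply @is_derive_minus; [now apply D0|].
  apply @is_derive_scal, @is_derive_id. }
destruct (lim_of_exp_decay (fun x => f x - a * x) (fun x => a - f1 x) (9 / 2)
  (21 / 10 ^ 6 / (58 / 10) / (58 / 10)) (58 / 10)) as [b [Lb Hb]]; [lra| | |].
{ intros x Hx; apply Dl; lra. }
{ intros x Hx; specialize (Ha x Hx); specialize (Ha' x ltac:(lra)).
  split; [lra|unfold a; lra]. }
assert (Hb' : forall x, 0 <= x -> b <= f x - a * x).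
{ intros x Hx; pose proof (Rmax_l x (9 / 2)); pose proof (Rmax_r x (9 / 2)).
  pose proof (derive_le (fun x => f x - a * x) (fun _ => 0) (fun x => - (a - f1 x))
    (fun _ => 0) x (Rmax x (9 / 2)) ltac:(lra)) as H1.
  specialize (H1 ltac:(intros; apply Dl; lra) ltac:(intros; apply @is_derive_const)).
  specialize (H1 ltac:(intros z Hz; specialize (Ha' z ltac:(lra)); lra)).
  specialize (Hb (Rmax x (9 / 2)) ltac:(lra)); lra. }
pose proof (Hb (9 / 2) ltac:(lra)) as HbX; rewrite E0 in HbX.
destruct (lim_of_exp_decay (fun x => (a * x + b) ^ 2 / (2 * a) - Phi x)
  (fun x => f x - a * x - b) (9 / 2)
  (21 / 10 ^ 6 / (58 / 10) / (58 / 10) / (58 / 10)) (58 / 10)) as [l [Ll Hl]];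
  [lra| | |].
{ intros x Hx; replace (- (f x - a * x - b)) with ((a * x + b) - f x) by ring.
  apply @is_derive_minus; [|apply D2; lra].
  auto_derive; trivial; simpl; field; lra. }
{ intros x Hx; specialize (Hb x Hx); lra. }
pose proof (Hl (9 / 2) ltac:(lra)) as HlX; rewrite E0 in HlX.
exists a, b, l.
split; [trivial|split; [trivial|split; [trivial|split; [trivial|]]]].
split; [trivial|split; [unfold a; lra|split; [trivial|split; lra]]].
Qed.

End Numerics.

(** * Numerical enclosure of a, b and c *)

Lemma exp_taylor5 (y : R) :
  1 + y + y ^ 2 / 2 + y ^ 3 / 6 + y ^ 4 / 24 + y ^ 5 / 120 <= exp y.
Proof.
pose (T := fun n => fun y : R => match n with
  | 0%nat => exp y - (1 + y)
  | 1%nat => exp y - (1 + y + y ^ 2 / 2)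
  | 2%nat => exp y - (1 + y + y ^ 2 / 2 + y ^ 3 / 6)
  | 3%nat => exp y - (1 + y + y ^ 2 / 2 + y ^ 3 / 6 + y ^ 4 / 24)
  | _ => exp y - (1 + y + y ^ 2 / 2 + y ^ 3 / 6 + y ^ 4 / 24 + y ^ 5 / 120)
  end).
assert (D : forall n x, (n < 4)%nat -> is_derive (T (S n)) x (T n x)).
{ intros [|[|[|[|n]]]] x Hn; try lia; unfold T; auto_derive; trivial; simpl; field. }
assert (T0 : forall n, T n 0 = 0).
{ intros [|[|[|[|n]]]]; unfold T; rewrite exp_0; simpl; field. }
assert (P0 : forall x, 0 <= T 0%nat x).
{ intros x; pose proof (exp_ineq1_le x); unfold T; lra. }
(* Successive Taylor remainders vanish at 0 and are primitives of each other. A nonnegative one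
   integrates to one with the sign of x, and that one integrates to a nonnegative one; odd Taylor
   degrees thus give lower bounds on the whole line. *)
assert (Odd : forall n, (n < 4)%nat -> (forall x, 0 <= T n x) ->
  (forall x, 0 <= x -> 0 <= T (S n) x) /\ (forall x, x <= 0 -> T (S n) x <= 0)).
{ intros n Hn H; split; intros x Hx; rewrite <- (T0 (S n));
    apply (derive_nonneg_le _ (T n)); auto. }
assert (Even : forall n, (n < 4)%nat -> (forall x, 0 <= x -> 0 <= T n x) ->
  (forall x, x <= 0 -> T n x <= 0) -> forall x, 0 <= T (S n) x).
{ intros n Hn H1 H2 x; destruct (Rle_dec 0 x) as [h|h].
  - rewrite <- (T0 (S n)); apply (derive_nonneg_le _ (T n)); auto.
    intros z Hz; apply H1; lra.
  - enough (- T (S n) x <= - T (S n) 0) by (rewrite T0 in *; lra).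
    apply (derive_nonneg_le (fun x => - T (S n) x) (fun x => - T n x)); [lra| |].
    + intros; apply @is_derive_opp; auto.
    + intros z Hz; specialize (H2 z ltac:(lra)); lra. }
destruct (Odd 0%nat ltac:(lia) P0) as [A1 B1].
pose proof (Even 1%nat ltac:(lia) A1 B1) as P2.
destruct (Odd 2%nat ltac:(lia) P2) as [A3 B3].
pose proof (Even 3%nat ltac:(lia) A3 B3 y) as P4; unfold T in P4; lra.
Qed.

Lemma exp_double_bounds (l : R) :
  - (3511586 / 10 ^ 7) <= l <= - (3511243 / 10 ^ 7) ->
  49541 / 10 ^ 5 <= exp l ^ 2 <= 4955 / 10 ^ 4.
Proof.
intros Hl.
assert (B : forall q z, 0 <= q -> q <= 1 + z + z ^ 2 / 2 + z ^ 3 / 6 + z ^ 4 / 24 + z ^ 5 / 120 ->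
  q ^ 4 <= exp (4 * z)).
{ intros q z Hq H; replace 4 with (INR 4) by (simpl; ring).
  rewrite exp_mul_INR; apply pow_incr; pose proof (exp_taylor5 z); lra. }
assert (M : forall x y, x <= y -> exp x <= exp y).
{ intros x y [h|h]; [left; now apply exp_increasing|rewrite h; lra]. }
(* 2 l is treated as 4 z with z near l / 2, small enough for degree 5 to suffice. Only lower bounds
   on exp are at hand, so the upper bound comes from exp (- 2 l) by inversion. *)
assert (L : (83897 / 10 ^ 5) ^ 4 <= exp (4 * - (175580 / 10 ^ 6))) by (apply B; lra).
assert (U : (119191 / 10 ^ 5) ^ 4 <= exp (4 * (175562 / 10 ^ 6))) by (apply B; lra).
replace (exp l ^ 2) with (exp (2 * l))
  by (rewrite <- exp_mul_INR; f_equal; simpl; ring).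
split.
- pose proof (M (4 * - (175580 / 10 ^ 6)) (2 * l) ltac:(lra)); lra.
- pose proof (M (2 * l) (- (4 * (175562 / 10 ^ 6))) ltac:(lra)) as H.
  apply Rle_trans with (1 := H); rewrite exp_Ropp.
  rewrite <- (Rinv_inv (4955 / 10 ^ 4)); apply Rinv_le_contravar; lra.
Qed.

Definition far_c (a l : R) : R := exp l / (4 * sqrt (a / 2) ^ 3).

(** Squaring removes the square root, so that c can be enclosed by rational inequalities alone. *)
Lemma far_c_sqr (a l : R) : 0 < a -> far_c a l ^ 2 * (2 * a ^ 3) = exp l ^ 2.
Proof.
intros Ha; unfold far_c.
assert (H : 0 < sqrt (a / 2)) by (apply sqrt_lt_R0; lra).
assert (E : sqrt (a / 2) ^ 2 = a / 2) by (apply pow2_sqrt; lra).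
set (r := sqrt (a / 2)) in *.
replace a with (2 * r ^ 2) by lra; field; lra.
Qed.

Lemma param_bounds (a b l v v1 p : R) :
  0 < a ->
  58829174 / 10 ^ 7 <= v <= 58829181 / 10 ^ 7 ->
  16551868 / 10 ^ 7 <= v1 <= 16551874 / 10 ^ 7 ->
  108057526 / 10 ^ 7 <= p <= 108057551 / 10 ^ 7 ->
  v1 <= a <= v1 + 363 / 10 ^ 8 ->
  b <= v - a * (9 / 2) <= b + 63 / 10 ^ 8 ->
  l <= (a * (9 / 2) + b) ^ 2 / (2 * a) - p <= l + 12 / 10 ^ 8 ->
  Rabs (a - a0) <= / 10 ^ 5 /\ Rabs (b - b0) <= 2 / 10 ^ 5 /\
  Rabs (far_c a l - c0) <= 2 / 10 ^ 5.
Proof.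
intros Ha Hv Hv1 Hp HA HB HL.
assert (Wb : 588291677 / 10 ^ 8 <= a * (9 / 2) + b <= 58829181 / 10 ^ 7) by lra.
split; [|split].
- unfold a0; apply Rabs_le; lra.
- unfold b0; apply Rabs_le; lra.
- set (w := a * (9 / 2) + b) in *.
  assert (w2 : (588291677 / 10 ^ 8) ^ 2 <= w ^ 2 <= (58829181 / 10 ^ 7) ^ 2)
    by (split; apply pow_incr; lra).
  (* Subtracting [p] yields the interval for [l] assumed by [exp_double_bounds]. *)
  assert (T : 104545967 / 10 ^ 7 <= w ^ 2 / (2 * a) <= 104546283 / 10 ^ 7).
  { split; [apply (Rle_div_r _ _ (2 * a))|apply (Rle_div_l _ _ (2 * a))]; lra. }
  destruct (exp_double_bounds l ltac:(lra)) as [E1 E2].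
  pose proof (far_c_sqr a l Ha) as Ec.
  assert (Pc : 0 < far_c a l).
  { apply Rdiv_lt_0_compat; [apply exp_pos|].
    apply Rmult_lt_0_compat; [lra|apply pow_lt, sqrt_lt_R0; lra]. }
  assert (a3 : (16551868 / 10 ^ 7) ^ 3 <= a ^ 3 <= (165519103 / 10 ^ 8) ^ 3)
    by (split; apply pow_incr; lra).
  set (c := far_c a l) in *; unfold c0; apply Rabs_le.
  assert (c2 : 0 <= c ^ 2) by apply pow2_ge_0.
  split.
  + apply Rnot_lt_le; intros h.
    assert (c ^ 2 <= (377 / 1613 - 2 / 10 ^ 5) ^ 2) by (apply pow_incr; lra).
    assert (c ^ 2 * (2 * a ^ 3) <= (377 / 1613 - 2 / 10 ^ 5) ^ 2
      * (2 * (165519103 / 10 ^ 8) ^ 3)) by (apply Rmult_le_compat; lra).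
    lra.
  + apply Rnot_lt_le; intros h.
    assert ((377 / 1613 + 2 / 10 ^ 5) ^ 2 <= c ^ 2) by (apply pow_incr; lra).
    assert ((377 / 1613 + 2 / 10 ^ 5) ^ 2 * (2 * (16551868 / 10 ^ 7) ^ 3)
      <= c ^ 2 * (2 * a ^ 3)) by (apply Rmult_le_compat; lra).
    lra.
Qed.

Lemma in_S_of_bounds (a b c : R) :
  Rabs (a - a0) <= / 10 ^ 5 -> Rabs (b - b0) <= 2 / 10 ^ 5 ->
  Rabs (c - c0) <= 2 / 10 ^ 5 -> in_S a b c.
Proof.
intros Ha Hb Hc; unfold in_S, rho0.
assert (S : forall u k, Rabs u <= k -> u ^ 2 <= k ^ 2).
{ intros u k H; rewrite <- pow2_abs; apply pow_incr; split; [apply Rabs_pos|trivial]. }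
apply S in Ha; apply S in Hb; apply S in Hc.
rewrite <- (sqrt_pow2 (5 / 10 ^ 5)) by lra.
apply sqrt_le_1_alt; lra.
Qed.

Lemma in_S_bounds (a b c : R) : in_S a b c ->
  Rabs (a - a0) <= 5 / 10 ^ 5 /\ Rabs (b - b0) <= / 10 ^ 4 /\
  Rabs (c - c0) <= / 10 ^ 4.
Proof.
intros H; unfold in_S, rho0 in H.
pose proof (pow2_ge_0 (a - a0)); pose proof (pow2_ge_0 (b - b0)).
pose proof (pow2_ge_0 (c - c0)).
apply (Rsqr_incr_1 _ _) in H; [|apply sqrt_pos|lra].
rewrite Rsqr_sqrt in H by lra; unfold Rsqr in H.
repeat split; apply Rabs_le_sqr; lra.
Qed.

(** * The far field *)

(** This is (a x + b) / sqrt (2 a), the affine square root of t. *)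
Definition far_var (a b x : R) : R := sqrt (a / 2) * x + b / (2 * sqrt (a / 2)).

Lemma sqrt_half_pos (a : R) : 0 < a -> 0 < sqrt (a / 2) /\ a = 2 * sqrt (a / 2) ^ 2.
Proof.
intros Ha; split; [apply sqrt_lt_R0; lra|].
rewrite pow2_sqrt; lra.
Qed.

Lemma tvar_far_var (a b x : R) : 0 < a -> tvar a b x = far_var a b x ^ 2.
Proof.
intros Ha; destruct (sqrt_half_pos a Ha) as [Hl E].
unfold tvar, far_var; set (r := sqrt (a / 2)) in *; clearbody r; subst a.
field; lra.
Qed.

Lemma erfc_gauss_tail (s : R) : erfc s = 2 / sqrt PI * gauss_tail s.
Proof. reflexivity. Qed.

(** With t = s^2, exp (- t) I0 is [gauss_D] and exp (- 2 t) (2 J0 - I0 - I0^2) is s times [gauss_k];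
    the prefactor sqrt (a / (2 t)) cancels the s in both terms. *)
Lemma F0_far_gauss (a b c x : R) : 0 < a -> 0 < far_var a b x ->
  let s := far_var a b x in
  F0_far a b c x =
  a * x + b + sqrt (a / 2) * (2 * c * gauss_D s + c ^ 2 * gauss_k s).
Proof.
intros Ha Hs; pose proof (tvar_far_var a b x Ha) as Et.
destruct (sqrt_half_pos a Ha) as [Hl Ea].
unfold F0_far; rewrite Et; set (s := far_var a b x) in *; clearbody s; clear Et.
assert (P : 0 < sqrt PI) by apply sqrt_lt_R0, PI_RGT_0.
assert (E1 : sqrt (s ^ 2) = s) by (apply sqrt_pow2; lra).
assert (E2 : sqrt (a / (2 * s ^ 2)) = sqrt (a / 2) / s).
{ rewrite <- (sqrt_pow2 (sqrt (a / 2) / s)) by (apply Rdiv_le_0_compat; lra).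
  f_equal; set (r := sqrt (a / 2)) in *; clearbody r; subst a; field; lra. }
assert (E3 : sqrt (PI * s ^ 2) = sqrt PI * s)
  by (rewrite sqrt_mult_alt, E1 by (left; apply PI_RGT_0); trivial).
assert (E4 : sqrt (2 * s ^ 2) = sqrt 2 * s)
  by (rewrite sqrt_mult_alt, E1 by lra; trivial).
assert (E5 : sqrt (2 * PI * s ^ 2) = sqrt 2 * (sqrt PI * s))
  by (rewrite Rmult_assoc, sqrt_mult_alt, E3 by lra; trivial).
unfold q0, I0, J0; rewrite 2!erfc_gauss_tail, E2, E3, E4, E5, E1.
unfold gauss_D, gauss_k.
rewrite (exp_Ropp (2 * s ^ 2)).
replace (exp (2 * s ^ 2)) with (exp (s ^ 2) * exp (s ^ 2))
  by (rewrite <- exp_plus; f_equal; ring).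
rewrite exp_Ropp.
pose proof (exp_pos (s ^ 2)).
set (g := exp (s ^ 2)) in *; set (r2 := sqrt 2); set (T := gauss_tail s).
set (T2 := gauss_tail (r2 * s)); set (rp := sqrt PI) in *; set (r := sqrt (a / 2)) in *.
field; lra.
Qed.

Lemma is_lim_affine (g : R -> R) (m k : R) :
  0 < k -> is_lim g p_infty 0 -> is_lim (fun s => g ((s - m) / k)) p_infty 0.
Proof.
intros Hk; rewrite 2!is_lim_p_infty_eps; intros H e He.
destruct (H e He) as [A HA]; exists (A * k + m); intros x Hx; apply HA.
apply (Rlt_div_r _ _ k); lra.
Qed.

Section FarField.

Variables (f f1 Phi : R -> R) (a b l : R).
Hypothesis flow : blasius_flow f f1 Phi.
Hypothesis La : is_lim f1 p_infty a.
Hypothesis Lb : is_lim (fun x => f x - a * x) p_infty b.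
Hypothesis Ll : is_lim (fun x => (a * x + b) ^ 2 / (2 * a) - Phi x) p_infty l.
Hypothesis f1_le : forall x, 0 <= x -> f1 x <= a.
Hypothesis b_le : forall x, 0 <= x -> b <= f x - a * x.
Hypothesis l_92 : (a * (9 / 2) + b) ^ 2 / (2 * a) - Phi (9 / 2) <= l + 12 / 10 ^ 8.
Hypothesis Ha : Rabs (a - a0) <= / 10 ^ 5.
Hypothesis Hb : Rabs (b - b0) <= 2 / 10 ^ 5.
Hypothesis Hc : Rabs (far_c a l - c0) <= 2 / 10 ^ 5.

(** [X] inverts [far_var], and the square in [V] is s^2. Since dX/ds = 1/lam, each derivative of V
    carries one more factor 1/lam. *)
Let lam := sqrt (a / 2).
Let mu := b / (2 * lam).
Let X (s : R) := (s - mu) / lam.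
Let V (s : R) := (a * X s + b) ^ 2 / (2 * a) - Phi (X s) - l.
Let V1 (s : R) := - (f (X s) - a * X s - b) / lam.
Let V2 (s : R) := - (f1 (X s) - a) / lam ^ 2.

Lemma param_pos : 165517 / 10 ^ 5 <= a <= 165521 / 10 ^ 5 /\
  - (156546 / 10 ^ 5) <= b <= - (15654 / 10 ^ 4) /\ 0 < far_c a l <= 2338 / 10000.
Proof.
apply Rabs_le_between in Ha; apply Rabs_le_between in Hb.
apply Rabs_le_between in Hc; unfold a0, b0, c0 in *; lra.
Qed.

Lemma lam_bounds : 90971 / 10 ^ 5 <= lam <= 90973 / 10 ^ 5 /\ a = 2 * lam ^ 2.
Proof.
destruct param_pos as (A & _).
destruct (sqrt_half_pos a ltac:(lra)) as [P E]; fold lam in P, E.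
split; [split|exact E]; apply Rnot_lt_le; intros h; nra.
Qed.

Lemma far_var_X (x : R) : X (far_var a b x) = x.
Proof.
destruct lam_bounds as [L _].
unfold X, mu, far_var; fold lam; field; lra.
Qed.

Lemma X_lower (s : R) : far_s <= s -> 2498 / 1000 <= X s.
Proof.
destruct lam_bounds as [L E]; destruct param_pos as (A & B & _).
unfold far_s; intros Hs; unfold X, mu.
replace ((s - b / (2 * lam)) / lam) with ((2 * lam * s - b) / a)
  by (rewrite E; field; lra).
apply (Rle_div_r _ _ a); [lra|]; nra.
Qed.

Lemma far_s_le (x : R) : 5 / 2 <= x -> far_s <= far_var a b x.
Proof.
destruct lam_bounds as [L E]; destruct param_pos as (A & B & _).
unfold far_s; intros Hx; unfold far_var; fold lam.
replace (lam * x + b / (2 * lam)) with ((a * x + b) / (2 * lam))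
  by (rewrite E; field; lra).
apply (Rle_div_r _ _ (2 * lam)); [lra|]; nra.
Qed.

Lemma is_derive_X (s : R) : is_derive X s (/ lam).
Proof.
destruct lam_bounds as [L _].
unfold X; auto_derive; trivial; field; lra.
Qed.

Lemma X_sqr (s : R) : (a * X s + b) ^ 2 / (2 * a) = s ^ 2.
Proof.
destruct lam_bounds as [L E]; unfold X, mu; rewrite E; field; lra.
Qed.

Lemma is_derive_comp_X (g g' : R -> R) (s : R) :
  (forall x, 0 <= x -> is_derive g x (g' x)) -> far_s <= s ->
  is_derive (fun s => g (X s)) s (g' (X s) / lam).
Proof.
intros D Hs; pose proof (X_lower s Hs).
replace (g' (X s) / lam) with (scal (/ lam) (g' (X s)))
  by (unfold scal; simpl; unfold mult; simpl; unfold Rdiv; ring).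
apply (is_derive_comp g X); [apply D; lra|apply is_derive_X].
Qed.

Lemma is_derive_V (s : R) : far_s <= s -> is_derive V s (V1 s).
Proof.
intros Hs; destruct lam_bounds as [L E].
replace (V1 s) with (((a * X s + b) - f (X s)) / lam - 0)
  by (unfold V1; field; lra).
apply @is_derive_minus; [|apply @is_derive_const].
apply (is_derive_comp_X (fun x => (a * x + b) ^ 2 / (2 * a) - Phi x)
  (fun x => (a * x + b) - f x)); trivial.
intros x Hx; apply @is_derive_minus; [|now apply flow].
auto_derive; trivial; simpl; field; rewrite E; nra.
Qed.

Lemma is_derive_V1 (s : R) : far_s <= s -> is_derive V1 s (V2 s).
Proof.
intros Hs; destruct lam_bounds as [L E].
replace (V2 s) with (- (f1 (X s) - a) / lam / lam) by (unfold V2; field; lra).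
apply (is_derive_comp_X (fun x => - (f x - a * x - b) / lam)
  (fun x => - (f1 x - a) / lam)); trivial.
intros x Hx.
pose proof (proj1 flow x Hx) as D.
auto_derive; [now exists (f1 x)|].
replace (Derive (fun x => f x) x) with (f1 x)
  by (symmetry; now apply is_derive_unique).
field; lra.
Qed.

Lemma is_derive_V2 (s : R) : far_s <= s ->
  is_derive V2 s (- (4 * far_c a l * exp (- s ^ 2) * exp (V s))).
Proof.
intros Hs; destruct lam_bounds as [L E].
replace (- (4 * far_c a l * exp (- s ^ 2) * exp (V s)))
  with (- exp (- Phi (X s)) / lam ^ 2 / lam).
- apply (is_derive_comp_X (fun x => - (f1 x - a) / lam ^ 2)
    (fun x => - exp (- Phi x) / lam ^ 2)); trivial.
  intros x Hx.
  pose proof (proj1 (proj2 flow) x Hx) as D.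
  auto_derive; [now eexists; exact D|].
  replace (Derive (fun x => f1 x) x) with (exp (- Phi x))
    by (symmetry; now apply is_derive_unique).
  field; lra.
(* The definition of [far_c] says exactly that exp l / lam^3 = 4 c. *)
- unfold far_c, V; rewrite X_sqr; fold lam.
  replace (s ^ 2 - Phi (X s) - l) with (s ^ 2 + (- Phi (X s) + - l)) by ring.
  rewrite 2!exp_plus, (exp_Ropp (s ^ 2)), (exp_Ropp l).
  pose proof (exp_pos (s ^ 2)); pose proof (exp_pos l); field; lra.
Qed.

Lemma is_lim_V : is_lim V p_infty 0.
Proof.
destruct lam_bounds as [L _].
apply (is_lim_affine (fun x => (a * x + b) ^ 2 / (2 * a) - Phi x - l)); [lra|].
replace (Finite 0) with (Finite (l - l)) by (f_equal; ring).
apply is_lim_minus'; [exact Ll|apply is_lim_const].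
Qed.

Lemma is_lim_V1 : is_lim V1 p_infty 0.
Proof.
destruct lam_bounds as [L _].
apply (is_lim_affine (fun x => - (f x - a * x - b) / lam)); [lra|].
apply is_lim_ext with (fun x => - / lam * (f x - a * x - b)).
- intros; field; lra.
- apply is_lim_scal0.
  replace (Finite 0) with (Finite (b - b)) by (f_equal; ring).
  apply is_lim_minus'; [exact Lb|apply is_lim_const].
Qed.

Lemma is_lim_V2 : is_lim V2 p_infty 0.
Proof.
destruct lam_bounds as [L _].
apply (is_lim_affine (fun x => - (f1 x - a) / lam ^ 2)); [lra|].
apply is_lim_ext with (fun x => - / lam ^ 2 * (f1 x - a)).
- intros; field; lra.
- apply is_lim_scal0.
  replace (Finite 0) with (Finite (a - a)) by (f_equal; ring).
  apply is_lim_minus'; [exact La|apply is_lim_const].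
Qed.

(** V is at most 1.2 10^-7 at x = 9/2. Back to x = 2.498 its slope in x is at most F - a x - b,
    which is nonincreasing and below 0.0126 there by the value of F at 5/2; so V <= 0.026, and exp V
    <= 1 / (1 - V). *)
Lemma V_upper (s : R) : far_s <= s -> exp (V s) <= 103 / 100.
Proof.
intros Hs; pose proof (X_lower s Hs) as Hx.
destruct param_pos as (A & B & _).
pose (L := fun x => (a * x + b) ^ 2 / (2 * a) - Phi x).
destruct flow as (D0 & _ & D2 & _).
assert (DL : forall x, 0 <= x -> is_derive L x (- (f x - a * x - b))).
{ intros x H; replace (- (f x - a * x - b)) with ((a * x + b) - f x) by ring.
  apply @is_derive_minus; [|now apply D2].
  auto_derive; trivial; simpl; field; lra. }
assert (U : forall x, 2498 / 1000 <= x -> f x - a * x - b <= 126 / 10 ^ 4).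
{ pose proof (proj2 (flow_at_52 _ _ _ flow)) as F52.
  pose proof (flow_f_incr _ _ _ flow (2498 / 1000) (5 / 2) ltac:(lra) ltac:(lra)).
  intros x H1.
  assert ((f x - a * x) - (f (2498 / 1000) - a * (2498 / 1000)) <= 0 - 0).
  { apply (derive_le (fun x => f x - a * x) (fun _ => 0) (fun x => f1 x - a * 1)
      (fun _ => 0)); trivial.
    - intros z Hz; apply @is_derive_minus; [apply D0; lra|].
      apply @is_derive_scal, @is_derive_id.
    - intros z Hz; apply @is_derive_const.
    - intros z Hz; specialize (f1_le z ltac:(lra)); lra. }
  lra. }
set (y := Rmax (X s) (9 / 2)).
assert (Hy : X s <= y /\ 9 / 2 <= y) by (split; [apply Rmax_l|apply Rmax_r]).
assert (Mon : forall x, X s <= x -> L x <= L (X s)).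
{ intros x H1; enough (L x - L (X s) <= 0 - 0) by lra.
  apply (derive_le L (fun _ => 0) (fun x => - (f x - a * x - b)) (fun _ => 0)); trivial.
  - intros; apply DL; lra.
  - intros; apply @is_derive_const.
  - intros z Hz; specialize (b_le z ltac:(lra)); lra. }
assert (VL : L (X s) - l <= 26 / 1000).
{ change ((a * (9 / 2) + b) ^ 2 / (2 * a) - Phi (9 / 2)) with (L (9 / 2)) in l_92.
  destruct (Rle_lt_dec (X s) (9 / 2)) as [h|h].
  - enough (126 / 10 ^ 4 * X s - 126 / 10 ^ 4 * (9 / 2) <= L (9 / 2) - L (X s)) by lra.
    enough (- L (9 / 2) - - L (X s) <= 126 / 10 ^ 4 * (9 / 2) - 126 / 10 ^ 4 * X s) by lra.
    apply (derive_le (fun x => - L x) (fun x => 126 / 10 ^ 4 * x)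
      (fun x => - - (f x - a * x - b)) (fun _ => 126 / 10 ^ 4 * 1)); trivial.
    + intros z Hz; apply @is_derive_opp, DL; lra.
    + intros z Hz; apply @is_derive_scal, @is_derive_id.
    + intros z Hz; specialize (U z ltac:(lra)); lra.
  - enough (L (X s) <= L (9 / 2)) by lra.
    enough (L (X s) - L (9 / 2) <= 0 - 0) by lra.
    apply (derive_le L (fun _ => 0) (fun x => - (f x - a * x - b)) (fun _ => 0)).
    + lra.
    + intros; apply DL; lra.
    + intros; apply @is_derive_const.
    + intros z Hz; specialize (b_le z ltac:(lra)); lra. }
change (exp (L (X s) - l) <= 103 / 100).
pose proof (exp_ineq1_le (- (L (X s) - l))) as HE; rewrite exp_Ropp in HE.
pose proof (exp_pos (L (X s) - l)).
set (e := exp (L (X s) - l)) in *.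
rewrite <- (Rinv_inv e), <- (Rinv_inv (103 / 100)).
apply Rinv_le_contravar; lra.
Qed.

Lemma far_error (F : R -> R) : (forall x, 0 <= x -> F x = f x) ->
  far_error_bounds F a b (far_c a l).
Proof.
intros HF; destruct lam_bounds as [HL E]; destruct param_pos as (A & B & C).
set (c := far_c a l) in *.
assert (Ds : forall x, is_derive (far_var a b) x lam).
{ intros x; unfold far_var; fold lam; auto_derive; trivial; ring. }
assert (Comp : forall g g' x, (forall s, far_s <= s -> is_derive g s (g' s)) -> 5 / 2 <= x ->
  is_derive (fun x => g (far_var a b x)) x (lam * g' (far_var a b x))).
{ intros g g' x D Hx; pose proof (far_s_le x Hx).
  change (lam * g' (far_var a b x)) with (scal lam (g' (far_var a b x))).
  apply (is_derive_comp g (far_var a b)); [now apply D|apply Ds]. }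
pose proof (is_derive_far_e c V1 V2 is_derive_V1) as DE.
pose proof (is_derive_far_e1 c V V2 is_derive_V2) as DE1.
exists (fun x => lam ^ 2 * far_e1 c V2 (far_var a b x)),
  (fun x => lam ^ 3 * far_e2 c V (far_var a b x)).
split; [|split].
- apply derivative_on_is_derive with (fun x => lam * far_e c V1 (far_var a b x)).
  + intros x Hx; pose proof (far_s_le x Hx) as Hs.
    rewrite F0_far_gauss by (unfold far_s in Hs; lra); fold lam.
    unfold far_e, V1; rewrite far_var_X, HF by lra; field; lra.
  + intros x Hx.
    replace (lam ^ 2 * far_e1 c V2 (far_var a b x))
      with (lam * (lam * far_e1 c V2 (far_var a b x))) by ring.
    apply @is_derive_scal, (Comp (far_e c V1) (far_e1 c V2)); trivial.
- apply derivative_on_is_derive with (fun x => lam ^ 2 * far_e1 c V2 (far_var a b x));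
    trivial.
  intros x Hx.
  replace (lam ^ 3 * far_e2 c V (far_var a b x))
    with (lam ^ 2 * (lam * far_e2 c V (far_var a b x))) by ring.
  apply @is_derive_scal, (Comp (far_e1 c V2) (far_e2 c V)); trivial.
- intros x Hx; pose proof (far_s_le x Hx) as Hs.
  destruct (far_s_pos _ Hs) as [Ps _].
  cbv zeta; rewrite tvar_far_var by lra.
  assert (EE : F x - F0_far a b c x = lam * far_e c V1 (far_var a b x)).
  { rewrite F0_far_gauss by first [exact Ps|lra]; fold lam.
    unfold far_e, V1; rewrite far_var_X, HF by lra; field; lra. }
  rewrite EE; set (s := far_var a b x) in *.
  pose proof (far_e_bound c V V1 V2 (proj1 C) (proj2 C) is_derive_V is_derive_V1
    is_derive_V2 is_lim_V is_lim_V1 is_lim_V2 V_upper s Hs) as B0.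
  pose proof (far_e1_bound c V V1 V2 (proj1 C) (proj2 C) is_derive_V is_derive_V1
    is_derive_V2 is_lim_V is_lim_V1 is_lim_V2 V_upper s Hs) as B1.
  pose proof (far_e2_bound c V V1 V2 (proj1 C) (proj2 C) is_derive_V is_derive_V1
    is_derive_V2 is_lim_V is_lim_V1 is_lim_V2 V_upper s Hs) as B2.
  assert (Pw : forall q n, - 2 * q = INR n -> Rpower (s ^ 2) q = (/ s) ^ n).
  { intros q n Hq; pose (r := - q); replace q with (- r) by (unfold r; ring).
    rewrite Rpower_Ropp, pow_inv; f_equal.
    rewrite <- (Rpower_pow 2 s), Rpower_mult by trivial.
    replace (INR 2 * r) with (INR n) by (rewrite <- Hq; unfold r; simpl; ring).
    now apply Rpower_pow. }
  rewrite (Pw (-2) 4%nat), (Pw (- (3 / 2)) 3%nat), (Pw (-1) 2%nat) by (simpl; lra).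
  pose proof (exp_pos (- (3 * s ^ 2))) as Pe.
  assert (Pi : 0 < / s) by now apply Rinv_0_lt_compat.
  assert (Pn : forall n, 0 < (/ s) ^ n * exp (- (3 * s ^ 2)))
    by (intros n; apply Rmult_lt_0_compat; trivial; now apply pow_lt).
  assert (L2 : 0 <= lam ^ 2 <= 8277 / 10 ^ 4) by lra.
  assert (L3 : 0 <= lam ^ 3 <= 7531 / 10 ^ 4).
  { replace (lam ^ 3) with (lam * lam ^ 2) by ring; split; [nra|].
    apply Rle_trans with (90973 / 10 ^ 5 * (8277 / 10 ^ 4)); [|lra].
    apply Rmult_le_compat; lra. }
  assert (Fin : forall k e C K n, 0 <= k -> 0 <= e <= C * (/ s) ^ n * exp (- (3 * s ^ 2)) ->
    k * C <= K -> 0 <= k * e <= K * (/ s) ^ n * exp (- (3 * s ^ 2))).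
  { intros k e C' K n Hk He HK; split; [apply Rmult_le_pos; lra|].
    apply Rle_trans with (k * (C' * (/ s) ^ n * exp (- (3 * s ^ 2))));
      [apply Rmult_le_compat_l; lra|].
    specialize (Pn n).
    replace (k * (C' * (/ s) ^ n * exp (- (3 * s ^ 2))))
      with (k * C' * ((/ s) ^ n * exp (- (3 * s ^ 2)))) by ring.
    rewrite (Rmult_assoc K); apply Rmult_le_compat_r; lra. }
  (* With lam near 0.9097, lam / 60000, lam^2 / 10^4 and 6 lam^3 / 10^4 are each about nine tenths
     of the required constant. *)
  apply (Fin lam _ _ (169 / 10 ^ 7)) in B0; [|lra|lra].
  apply (Fin (lam ^ 2) _ _ (920 / 10 ^ 7)) in B1; [|lra|lra].
  apply (Fin (lam ^ 3) _ _ (502 / 10 ^ 6)) in B2; [|lra|lra].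
  split; [|split]; apply Rabs_le; lra.
Qed.

End FarField.

(** * Uniqueness *)

Lemma is_lim_far_var (g : R -> R) (a b : R) : 0 < a ->
  is_lim g p_infty 0 -> is_lim (fun x => g (far_var a b x)) p_infty 0.
Proof.
intros Ha Hg; destruct (sqrt_half_pos a Ha) as [L _].
apply is_lim_ext with (fun x => g ((x - - (b / (2 * sqrt (a / 2)) / sqrt (a / 2)))
  / / sqrt (a / 2))).
- intros x; f_equal; unfold far_var; field; lra.
- apply is_lim_affine; trivial; now apply Rinv_0_lt_compat.
Qed.

Lemma is_lim_affine_0 (p q : R) :
  is_lim (fun x => p * x + q) p_infty 0 -> p = 0 /\ q = 0.
Proof.
intros H; rewrite is_lim_p_infty_eps in H.
assert (Z : forall r, (forall e, 0 < e -> Rabs r < e) -> r = 0).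
{ intros r Hr; destruct (Req_dec r 0) as [|N]; trivial.
  specialize (Hr _ (Rabs_pos_lt r N)); lra. }
assert (P : p = 0).
{ apply Z; intros e He; destruct (H (e / 2) ltac:(lra)) as [A HA].
  pose proof (HA (A + 1) ltac:(lra)) as H1; pose proof (HA (A + 2) ltac:(lra)) as H2.
  apply Rabs_def2 in H1; apply Rabs_def2 in H2; apply Rabs_def1; lra. }
split; trivial; apply Z; intros e He; destruct (H e He) as [A HA].
specialize (HA (A + 1) ltac:(lra)); rewrite P in HA.
now replace (0 * (A + 1) + q - 0) with q in HA by ring.
Qed.

Lemma is_lim_gauss : is_lim (fun s => exp (- s ^ 2)) p_infty 0.
Proof.
apply (gauss_le_lim0 _ 1 1); intros s Hs.
rewrite Rabs_pos_eq by (left; apply exp_pos).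
assert (1 <= s ^ 2) by nra; pose proof (exp_pos (- s ^ 2)); nra.
Qed.

(** For a competing triple only membership in S is known; s >= 1 is enough to discard the negative
    powers of t. *)
Lemma far_var_ge_1 (a b c x : R) : in_S a b c -> 5 / 2 <= x ->
  0 < a /\ 1 <= far_var a b x.
Proof.
intros HS Hx; destruct (in_S_bounds a b c HS) as (Ha & Hb & _).
apply Rabs_le_between in Ha; apply Rabs_le_between in Hb; unfold a0, b0 in *.
assert (A : 16551 / 10 ^ 4 <= a <= 16553 / 10 ^ 4) by lra.
split; [lra|].
destruct (sqrt_half_pos a ltac:(lra)) as [L E].
unfold far_var; set (r := sqrt (a / 2)) in *.
assert (R1 : 9 / 10 <= r <= 91 / 100) by (split; apply Rnot_lt_le; intros h; nra).
replace (r * x + b / (2 * r)) with ((a * x + b) / (2 * r)) by (rewrite E; field; lra).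
apply (Rle_div_r _ _ (2 * r)); [lra|]; nra.
Qed.

Lemma Rpower_le_1 (t q : R) : 1 <= t -> q <= 0 -> Rpower t q <= 1.
Proof.
intros Ht Hq; rewrite <- (Rpower_O t) by lra; now apply Rle_Rpower.
Qed.

Lemma is_lim_F0_far (a b c : R) : in_S a b c ->
  is_lim (fun x => F0_far a b c x - (a * x + b)) p_infty 0.
Proof.
intros HS; pose proof (proj1 (far_var_ge_1 a b c _ HS (Rle_refl _))) as Ha.
set (r := sqrt (a / 2)).
apply is_lim_squeeze0 with (f := fun x => F0_far a b c x - (a * x + b))
  (g := fun x => Rabs (r * (2 * c * gauss_D (far_var a b x) + c ^ 2 * gauss_k (far_var a b x))))
  (A := 5 / 2).
- intros x Hx; pose proof (proj2 (far_var_ge_1 a b c x HS ltac:(lra))).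
  rewrite F0_far_gauss by lra; fold r; right; f_equal; ring.
- replace (Finite 0) with (Rbar_abs 0) by (simpl; now rewrite Rabs_R0).
  apply is_lim_Rabs, is_lim_scal0, is_lim_plus0; apply is_lim_scal0;
    apply is_lim_far_var; trivial; [apply is_lim_gauss_D|apply is_lim_gauss_k].
Qed.

Lemma far_error_asymptote (F : R -> R) (a b c : R) :
  in_S a b c -> far_error_bounds F a b c ->
  is_lim (fun x => F x - (a * x + b)) p_infty 0.
Proof.
intros HS (E1 & E2 & _ & _ & H).
pose proof (proj1 (far_var_ge_1 a b c _ HS (Rle_refl _))) as Ha.
apply is_lim_ext with (fun x => (F x - F0_far a b c x) + (F0_far a b c x - (a * x + b)));
  [intros; ring|].
apply is_lim_plus0; [|now apply is_lim_F0_far].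
apply is_lim_squeeze0 with (fun x => exp (- far_var a b x ^ 2)) (5 / 2).
- intros x Hx; destruct (H x ltac:(lra)) as [B _].
  pose proof (proj2 (far_var_ge_1 a b c x HS ltac:(lra))) as Hs.
  apply Rle_trans with (1 := B); rewrite tvar_far_var by trivial.
  set (s := far_var a b x) in *.
  assert (St : 1 <= s ^ 2) by nra.
  pose proof (Rpower_le_1 (s ^ 2) (-2) St ltac:(lra)).
  assert (0 < Rpower (s ^ 2) (-2)) by apply exp_pos.
  assert (exp (- (3 * s ^ 2)) <= exp (- s ^ 2)) by (left; apply exp_increasing; lra).
  pose proof (exp_pos (- (3 * s ^ 2))).
  assert (Rpower (s ^ 2) (-2) * exp (- (3 * s ^ 2)) <= 1 * exp (- s ^ 2))
    by (apply Rmult_le_compat; lra).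
  lra.
- apply (is_lim_far_var (fun s => exp (- s ^ 2))); trivial; apply is_lim_gauss.
Qed.

(** E'' is of order exp (- 3 t), while F'' and F0'' are of order exp (- t). Multiplying by exp t and
    going to infinity leaves exp l from F'' and 4 (a / 2)^(3/2) c from F0'', which must agree. *)
Lemma far_error_c (F f f1 Phi : R -> R) (a b l c : R) :
  (forall x, 0 <= x -> F x = f x) -> blasius_flow f f1 Phi ->
  is_lim (fun x => (a * x + b) ^ 2 / (2 * a) - Phi x) p_infty l ->
  in_S a b c -> far_error_bounds F a b c -> c = far_c a l.
Proof.
intros HF (D0 & D1 & _) Ll HS (e1 & e2 & DE & DE1 & H).
pose proof (proj1 (far_var_ge_1 a b c _ HS (Rle_refl _))) as Ha.
destruct (sqrt_half_pos a Ha) as [L Ea]; set (r := sqrt (a / 2)) in *.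
assert (Loc : forall x, 5 / 2 < x -> locally x (fun y => 5 / 2 < y)).
{ intros x Hx; exists (mkposreal (x - 5 / 2) ltac:(lra)); intros y Hy.
  apply Rabs_def2 in Hy; unfold minus, plus, opp in Hy; simpl in Hy; lra. }
assert (Loc' : forall x, 5 / 2 < x -> locally x (fun y => 5 / 2 <= y)).
{ intros x Hx; apply filter_imp with (2 := Loc x Hx); intros; lra. }
assert (Ds : forall g g' x, (forall s, is_derive g s (g' s)) ->
  is_derive (fun x => g (far_var a b x)) x (r * g' (far_var a b x))).
{ intros g g' x D; change (r * g' (far_var a b x)) with (scal r (g' (far_var a b x))).
  apply (is_derive_comp g (far_var a b)); [apply D|].
  unfold far_var; fold r; auto_derive; trivial; ring. }
pose (d1 := fun x => f1 x - a - r * (2 * c * (r * - (2 * gauss_tail (far_var a b x)))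
  + c ^ 2 * (r * gauss_k1 (far_var a b x)))).
(* The derivatives in the error bounds are given only by their existence; at interior points
   uniqueness of the derivative identifies them with explicit formulas. *)
assert (E1 : forall x, 5 / 2 < x -> e1 x = d1 x).
{ intros x Hx.
  pose proof (is_derive_derivative_on _ _ _ x DE (Rlt_le _ _ Hx) (Loc' x Hx)) as De.
  rewrite <- (is_derive_unique _ _ _ De).
  apply is_derive_unique.
  apply is_derive_ext_loc with (fun x => f x - (a * x + b)
    - r * (2 * c * gauss_D (far_var a b x) + c ^ 2 * gauss_k (far_var a b x))).
  - apply filter_imp with (2 := Loc x Hx); intros y Hy; cbv beta.
    pose proof (proj2 (far_var_ge_1 a b c y HS ltac:(lra))).
    rewrite F0_far_gauss, HF by lra; fold r.
    match goal with |- ?u = ?v => change (@eq R u v) end; ring.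
  - unfold d1; apply @is_derive_minus; [apply @is_derive_minus|].
    + apply D0; lra.
    + auto_derive; trivial; ring.
    + apply @is_derive_scal, @is_derive_plus; apply @is_derive_scal.
      * apply (Ds gauss_D (fun s => - (2 * gauss_tail s))), is_derive_gauss_D.
      * apply (Ds gauss_k gauss_k1), is_derive_gauss_k. }
assert (E2 : forall x, 5 / 2 < x -> e2 x = exp (- Phi x)
  - 4 * r ^ 3 * c * exp (- far_var a b x ^ 2) * (1 + c * gauss_H (far_var a b x))).
{ intros x Hx.
  pose proof (is_derive_derivative_on _ _ _ x DE1 (Rlt_le _ _ Hx) (Loc' x Hx)) as De.
  rewrite <- (is_derive_unique _ _ _ De).
  apply is_derive_unique.
  apply is_derive_ext_loc with d1.
  - apply filter_imp with (2 := Loc x Hx); intros y Hy; cbv beta; now rewrite E1.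
  - replace (exp (- Phi x)
      - 4 * r ^ 3 * c * exp (- far_var a b x ^ 2) * (1 + c * gauss_H (far_var a b x)))
      with (exp (- Phi x) - 0 -
        r * (2 * c * (r * - (2 * (r * - exp (- far_var a b x ^ 2))))
        + c ^ 2 * (r * (r * (4 * exp (- far_var a b x ^ 2) * gauss_H (far_var a b x))))))
      by ring.
    unfold d1; apply @is_derive_minus; [apply @is_derive_minus|].
    + apply D1; lra.
    + apply @is_derive_const.
    + apply @is_derive_scal, @is_derive_plus; apply @is_derive_scal, @is_derive_scal.
      * apply @is_derive_opp, @is_derive_scal.
        apply (Ds gauss_tail (fun s => - exp (- s ^ 2))), is_derive_gauss_tail.
      * apply (Ds gauss_k1 (fun s => 4 * exp (- s ^ 2) * gauss_H s)), is_derive_gauss_k1. }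
assert (Z : is_lim (fun x => exp ((a * x + b) ^ 2 / (2 * a) - Phi x)
  - 4 * r ^ 3 * c * (1 + c * gauss_H (far_var a b x))) p_infty 0).
{ apply is_lim_squeeze0 with (fun x => exp (- far_var a b x ^ 2)) (5 / 2).
  - intros x Hx; destruct (H x ltac:(lra)) as (_ & _ & B).
    pose proof (proj2 (far_var_ge_1 a b c x HS ltac:(lra))) as Hs.
    cbv zeta in B; rewrite E2, tvar_far_var in B by trivial.
    assert (Es : (a * x + b) ^ 2 / (2 * a) = far_var a b x ^ 2).
    { rewrite <- tvar_far_var by trivial; unfold tvar; field; lra. }
    rewrite Es; set (s := far_var a b x) in *.
    assert (St : 1 <= s ^ 2) by nra.
    pose proof (Rpower_le_1 (s ^ 2) (-1) St ltac:(lra)).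
    assert (0 < Rpower (s ^ 2) (-1)) by apply exp_pos.
    replace (exp (s ^ 2 - Phi x) - 4 * r ^ 3 * c * (1 + c * gauss_H s))
      with (exp (s ^ 2) * (exp (- Phi x)
        - 4 * r ^ 3 * c * exp (- s ^ 2) * (1 + c * gauss_H s))).
    + rewrite Rabs_mult, (Rabs_pos_eq (exp (s ^ 2))) by (left; apply exp_pos).
      replace (exp (- s ^ 2)) with (exp (s ^ 2) * exp (- (2 * s ^ 2)))
        by (rewrite <- exp_plus; f_equal; ring).
      apply Rmult_le_compat_l; [left; apply exp_pos|].
      replace (exp (s ^ 2) * exp (- (2 * s ^ 2))) with (exp (- s ^ 2))
        by (rewrite <- exp_plus; f_equal; ring).
      apply Rle_trans with (1 := B).
      assert (exp (- (3 * s ^ 2)) <= exp (- (2 * s ^ 2)))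
        by (left; apply exp_increasing; lra).
      pose proof (exp_pos (- (3 * s ^ 2))).
      assert (Rpower (s ^ 2) (-1) * exp (- (3 * s ^ 2)) <= 1 * exp (- (2 * s ^ 2)))
        by (apply Rmult_le_compat; lra).
      lra.
    + unfold Rminus at 3; rewrite exp_plus, (exp_Ropp (s ^ 2)).
      pose proof (exp_pos (s ^ 2)); field; lra.
  - apply (is_lim_far_var (fun s => exp (- s ^ 2))); trivial; apply is_lim_gauss. }
assert (Z1 : is_lim (fun x => exp ((a * x + b) ^ 2 / (2 * a) - Phi x)) p_infty
  (4 * r ^ 3 * c)).
{ apply is_lim_ext with (fun x => (exp ((a * x + b) ^ 2 / (2 * a) - Phi x)
    - 4 * r ^ 3 * c * (1 + c * gauss_H (far_var a b x)))
    + 4 * r ^ 3 * c * c * gauss_H (far_var a b x) + 4 * r ^ 3 * c); [intros; ring|].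
  replace (Finite (4 * r ^ 3 * c)) with (Finite (0 + 4 * r ^ 3 * c)) by (f_equal; ring).
  apply is_lim_plus'; [|apply is_lim_const].
  apply is_lim_plus0; [exact Z|].
  apply is_lim_scal0, is_lim_far_var; trivial; apply is_lim_gauss_H. }
assert (Z2 : is_lim (fun x => exp ((a * x + b) ^ 2 / (2 * a) - Phi x)) p_infty (exp l)).
{ apply (filterlim_comp _ _ _ (fun x => (a * x + b) ^ 2 / (2 * a) - Phi x) exp
    _ (locally l)); [exact Ll|].
  apply (ex_derive_continuous exp); auto_derive; trivial. }
assert (Eq : 4 * r ^ 3 * c = exp l).
{ apply is_lim_unique in Z1; apply is_lim_unique in Z2.
  rewrite Z1 in Z2; now injection Z2. }
unfold far_c; fold r; rewrite <- Eq; field; lra.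
Qed.

Theorem theorem1 (F : R -> R) (hF : blasius_solution F) :
  exists! abc : R * R * R,
    let '(a, b, c) := abc in
    in_S a b c /\ near_error_bounds F /\ far_error_bounds F a b c.
Proof.
destruct (blasius_exp F hF) as (f & f1 & Phi & HF & flow).
destruct (flow_limits f f1 Phi flow)
  as (a & b & l & Ha & La & Lb & Ll & Ba & HA & Bb & HB & HL).
destruct (flow_at_92 f f1 Phi flow) as (Nf & Nf1 & _ & NP).
destruct (param_bounds a b l _ _ _ Ha Nf Nf1 NP HA) as (Pa & Pb & Pc);
  [split; [apply Bb; lra|exact HB]|exact HL|].
exists (a, b, far_c a l); split.
- split; [now apply in_S_of_bounds|split].
  + now apply near_error with f f1 Phi.
  + now apply far_error with f f1 Phi.
- intros [[a' b'] c'] (HS & _ & HE).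
  pose proof (far_error_asymptote F a' b' c' HS HE) as LF.
  (* Both a x + b and a' x + b' are asymptotes of F, so their difference tends to 0. *)
  destruct (is_lim_affine_0 (a' - a) (b' - b)) as [Ea Eb].
  { apply is_lim_squeeze0 with (fun x =>
      Rabs ((f x - a * x - b) + -1 * (F x - (a' * x + b')))) 0.
    - intros x Hx; rewrite HF by lra; right; f_equal; ring.
    - replace (Finite 0) with (Rbar_abs 0) by (simpl; now rewrite Rabs_R0).
      apply is_lim_Rabs, is_lim_plus0; [|now apply is_lim_scal0].
      replace (Finite 0) with (Finite (b - b)) by (f_equal; ring).
      apply is_lim_minus'; [exact Lb|apply is_lim_const]. }
  replace a' with a in * by lra; replace b' with b in * by lra.
  now rewrite (far_error_c F f f1 Phi a b l c').
Qed.
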